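(* Let $m\ge 3$ and let $\mathfrak g$ be the simple Lie algebra of type $D_m$. Let $1\le j\le m-2$ and $J=\{j,j+1,\dots,m-2,m-1,m\}$. If $s_{i_1}\cdots s_{i_l}$ is any reduced word for the longest element of the subgroup $W_J=\langle s_k:k\in J\rangle$ of the Weyl group, then $$c_J\sim c_{i_1}\cdots c_{i_l}$$ as maps on the crystal $B(n\varpi_1)$, for every $n\ge1$.
   Context: Setting. $I=\{1,\dots,m\}$ is the Dynkin diagram of type $D_m$ with spin nodes $m-1,m$ (both adjacent to $m-2$; $i$ is adjacent to $i+1$ for $i\le m-2$), $\alpha_i=\epsilon_i-\epsilon_{i+1}$ for $i\le m-1$, $\alpha_m=\epsilon_{m-1}+\epsilon_m$, $W=\langle s_i\rangle$ is the Weyl group. The crystal $B(n\varpi_1)$ is the set of rows $b_1b_2\cdots b_n$ of length $n$, weakly increasing in the poset $1<2<\dots<m-1<m,\overline m<\overline{m-1}<\dots<\overline 1$ in which $m$ and $\overline m$ are incomparable (so $m,\overline m$ never both appear). The weight is the sum of the weights of the entries, $\mathrm{wt}(i)=\epsilon_i$, $\mathrm{wt}(\overline i)=-\epsilon_i$. On single letters: $f_i(i)=i+1$, $f_i(\overline{i+1})=\overline i$ for $1\le i\le m-1$; $f_m(m-1)=\overline m$, $f_m(m)=\overline{m-1}$; all other $f_i$ of letters are $0$; $e_i(x)=y$ iff $f_i(y)=x$. On a row, for fixed $i$, write from left to right a $+$ for each letter $x$ with $f_i(x)\ne0$ and a $-$ for each letter with $e_i(x)\neq 0$, successively cancel pairs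 $-+$, leaving $+\cdots+-\cdots-$; $f_i$ applies $f_i$ to the letter of the rightmost uncancelled $+$ (result $0$ if none) and $e_i$ applies $e_i$ to the letter of the leftmost uncancelled $-$ (result $0$ if none). Cactus action. For connected $J\subseteq I$ let $w_{0,J}$ be the longest element of $W_J=\langle s_j: j\in J\rangle$ and $\theta_J:J\to J$ be given by $\alpha_{\theta_J(j)}=-w_{0,J}\alpha_j$. Then $c_J$ acts on $B(n\varpi_1)$ as the unique map preserving each connected component of the crystal restricted to $J$ (keep only edges labelled by $J$) and satisfying $\mathrm{wt}(c_J b)=w_{0,J}\mathrm{wt}(b)$, $e_j c_J(b)=c_J(f_{\theta_J(j)}b)$, $f_jc_J(b)=c_J(e_{\theta_J(j)}b)$ for $j\in J$ (with $c_J(0)=0$). Write $c_k=c_{\{k\}}$; it reverses each $k$-string. Products are compositions of maps (rightmost applied first), and $\sim$ means equality as maps on $B(n\varpi_1)$ for all $n\ge1$. *)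

(* Defs.v *)
From HB Require Import structures.
From mathcomp Require Import all_boot all_order all_algebra.
From Stdlib Require Import ClassicalEpsilon.

Set Implicit Arguments.
Unset Strict Implicit.
Unset Printing Implicit Defensive.

Import GRing.Theory.

(* Nodes of the Dynkin diagram D_m and indices of letters are numbered from 0:
   k : 'I_m stands for node k+1, so the spin nodes are m-2 and m-1, and
   (false, k), (true, k) stand for the letters k+1 and \overline{k+1}. *)

Section TypeD.

Variable m : nat.

Local Open Scope ring_scope.

(* Column vectors are coordinates in the basis epsilon_1, ..., epsilon_m. *)
Definition simple_root (i : 'I_m) : 'cV[int]_m :=
  \col_k (if (i.+1 < m)%N then (k == i :> nat)%:R - (k == i.+1 :> nat)%:R
          else (k.+2 == m)%:R + (k.+1 == m)%:R).

(* v |-> v - (v, alpha_i) alpha_i, as (alpha_i, alpha_i) = 2 *)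
Definition simple_refl (i : 'I_m) : 'M[int]_m :=
  1%:M - simple_root i *m (simple_root i)^T.

Definition weyl_word (w : seq 'I_m) : 'M[int]_m :=
  \big[mulmx/1%:M]_(i <- w) simple_refl i.

Definition reduced_word (w : seq 'I_m) (g : 'M[int]_m) : Prop :=
  weyl_word w = g /\ forall v, weyl_word v = g -> (size w <= size v)%N.

Definition in_parabolic (J : {set 'I_m}) (g : 'M[int]_m) : Prop :=
  exists2 w, all (mem J) w & weyl_word w = g.

Definition is_longest (J : {set 'I_m}) (g : 'M[int]_m) : Prop :=
  in_parabolic J g /\
  forall h u v, in_parabolic J h -> reduced_word u h -> reduced_word v g ->
    (size u <= size v)%N.

Definition longest (J : {set 'I_m}) : 'M[int]_m :=
  epsilon (inhabits 1%:M) (is_longest J).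

(* The default value j is never used: theta permutes J. *)
Definition theta (J : {set 'I_m}) (j : 'I_m) : 'I_m :=
  odflt j [pick k in J | simple_root k == - (longest J *m simple_root j)].

Definition letter : predArgType := (bool * 'I_m)%type.
HB.instance Definition _ := Finite.on letter.

Definition letter_le (x y : letter) : bool :=
  match x, y with
  | (false, a), (false, b) => (a <= b)%N
  | (true, a), (true, b) => (b <= a)%N
  | (false, a), (true, b) => (a.+1 < m)%N || (b.+1 < m)%N
  | (true, _), (false, _) => false
  end.

(* letter_arrow i x y means f_i(x) = y. *)
Definition letter_arrow (i : 'I_m) (x y : letter) : bool :=
  match x, y with
  | (false, a), (false, b) => [&& (i.+1 < m)%N, a == i & b == i.+1 :> nat]
  | (true, a), (true, b) => [&& (i.+1 < m)%N, a == i.+1 :> nat & b == i]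
  | (false, a), (true, b) =>
      (i.+1 == m) && ((a.+2 == m) && (b.+1 == m) || (a.+1 == m) && (b.+2 == m))
  | (true, _), (false, _) => false
  end.

Definition letter_f (i : 'I_m) (x : letter) : option letter :=
  [pick y | letter_arrow i x y].

Definition letter_e (i : 'I_m) (y : letter) : option letter :=
  [pick x | letter_arrow i x y].

Definition letter_wt (x : letter) : 'cV[int]_m :=
  (-1) ^+ x.1 *: delta_mx x.2 ord0.

Section Rows.

Variable n : nat.

Record crow : predArgType :=
  Crow { crow_val :> n.-tuple letter; _ : sorted letter_le crow_val }.
HB.instance Definition _ := [isSub for crow_val].
HB.instance Definition _ := [Finite of crow by <:].

Definition row_wt (b : crow) : 'cV[int]_m :=
  \sum_(p < n) letter_wt (tnth (val b) p).

(* true is the sign +, false is the sign -; each sign carries its position.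
   No letter has both f_i and e_i defined. *)
Definition signature (i : 'I_m) (b : n.-tuple letter) : seq (bool * 'I_n) :=
  pmap (fun p : 'I_n => if letter_f i (tnth b p) then Some (true, p)
                        else if letter_e i (tnth b p) then Some (false, p)
                        else None) (enum 'I_n).

(* A stack of uncancelled signs, the rightmost on top: a + cancels against a -
   on top of the stack. *)
Definition push_sign (st : seq (bool * 'I_n)) (s : bool * 'I_n) :=
  match s, st with
  | (true, _), (false, _) :: st' => st'
  | _, _ => s :: st
  end.

Definition uncancelled (i : 'I_m) (b : n.-tuple letter) : seq (bool * 'I_n) :=
  rev (foldl push_sign [::] (signature i b)).

Definition rightmost_plus (i : 'I_m) (b : n.-tuple letter) : option 'I_n :=
  ohead (rev [seq s.2 | s <- uncancelled i b & s.1]).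

Definition leftmost_minus (i : 'I_m) (b : n.-tuple letter) : option 'I_n :=
  ohead [seq s.2 | s <- uncancelled i b & ~~ s.1].

Definition replace_at (b : n.-tuple letter) (p : 'I_n) (y : letter) :
    n.-tuple letter :=
  [tuple if q == p then y else tnth b q | q < n].

Definition word_f (i : 'I_m) (b : n.-tuple letter) : option (n.-tuple letter) :=
  obind (fun p => omap (replace_at b p) (letter_f i (tnth b p)))
        (rightmost_plus i b).

Definition word_e (i : 'I_m) (b : n.-tuple letter) : option (n.-tuple letter) :=
  obind (fun p => omap (replace_at b p) (letter_e i (tnth b p)))
        (leftmost_minus i b).

(* None is the 0 of the crystal. Rows are stable under the operators on words,
   so insub discards nothing. *)
Definition row_f (i : 'I_m) (b : crow) : option crow :=
  obind insub (word_f i (val b)).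

Definition row_e (i : 'I_m) (b : crow) : option crow :=
  obind insub (word_e i (val b)).

Definition crystal_edge (J : {set 'I_m}) : rel crow :=
  [rel b b' | [exists j in J, (row_f j b == Some b') || (row_f j b' == Some b)]].

Definition is_cactus (J : {set 'I_m}) (c : crow -> crow) : Prop :=
  [/\ forall b, connect (crystal_edge J) b (c b),
      forall b, row_wt (c b) = longest J *m row_wt b,
      forall j b, j \in J -> row_e j (c b) = omap c (row_f (theta J j) b)
    & forall j b, j \in J -> row_f j (c b) = omap c (row_e (theta J j) b)].

(* For 3 <= m and J connected, exactly one map satisfies is_cactus J. *)
Definition cactus (J : {set 'I_m}) : crow -> crow :=
  epsilon (inhabits id) (is_cactus J).

Definition cactus_word (w : seq 'I_m) : crow -> crow :=
  foldr (fun i g => cactus [set i] \o g) id w.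

End Rows.

End TypeD.

(* Main.v *)
Require Import Defs.
From mathcomp Require Import all_boot all_order all_algebra.
From mathcomp Require Import zify.
From Stdlib Require Import ClassicalEpsilon.

(* Describe a row by t_i = min(x_i, y_i) and v_i = x_i - y_i, where x_i and y_i are
   the numbers of letters i and \bar i; thus v is the weight, and n is the sum of
   the 2 t_i + |v_i|. Computing the k-strings shows that c_k fixes t and acts on v
   by the simple reflection s_k, the spin nodes included because t_m = 0. When J
   is a tail of the diagram, c_J also fixes t and acts on v by w_{0,J}: it
   exchanges i and \bar i for i >= j, except i = m when |J| is odd. Hence c_J and
   c_{i_1} ... c_{i_l} both fix t and act on v by s_{i_1} ... s_{i_l} = w_{0,J}.
   Uniqueness of the cactus maps comes from the uniqueness of highest weight rows
   in a component, and w_{0,J} is identified as the element of W_J making the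
   regular vector rho antidominant, length being the number of inversions. *)

Set Implicit Arguments.
Unset Strict Implicit.
Unset Printing Implicit Defensive.

Import Order.TTheory GRing.Theory Num.Theory.

(** * Letters and arrows *)

(** A single operator need not keep t: along a k-string the minimum of the counts of [src k] and
    [bar (src k)] may vary. It only takes equal values at mirror-image rows, so reversal has the
    simple form [act] although the steps of the string do not. Both [cactus] and [longest] are
    chosen by [epsilon] from their characterizations, so each has to be recognised. An explicit map
    is shown to satisfy the cactus axioms, and uniqueness then identifies it. That the map stays
    within J-components, and that it is unique, both rest on an invariant separating the components:
    [string_inv] for a node, the counts of the letters of index below j for a tail. The latter
    suffices because the letters of index at least j form a row of a smaller crystal of the same
    kind, of type D_{m-j+1}, which is connected. *)

Section Letters.

Variable m : nat.
Hypothesis m_gt1 : 1 < m.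

Implicit Types (k : 'I_m) (x y z : letter m).

Definition bar x : letter m := (~~ x.1, x.2).

(* The simple root of node k is wt (src k) - wt (tgt k), and the k-arrows on
   letters are src k -> tgt k and bar (tgt k) -> bar (src k). This treats the
   node m-1 (a spin node) on the same footing as the others. *)
Definition src k : letter m := (false, if k.+1 < m then k else ord_pred k).
Definition tgt k : letter m :=
  if k.+1 < m then (false, ordS k) else (true, k).

(** A linear extension of the letter order, placing m just before \overline m, the only incomparable
    pair. It is used to sort letters into rows, as the measure that the operators change, and as the
    order in which [rho] decreases. *)
Definition rank x : nat := if x.1 then m.*2.-1 - x.2 else x.2.

Lemma barK : involutive bar.
Proof. by case=> [[] a]. Qed.

Lemma letter_eqE x y : (x == y) = (x.1 == y.1) && (x.2 == y.2 :> nat).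
Proof. by case: x => s a; case: y => t c; rewrite xpair_eqE -val_eqE. Qed.

Lemma src_val k : (src k).2 = (if k.+1 < m then k : nat else m - 2) :> nat.
Proof.
rewrite /src /=; case: ifP => //= hk; have := ltn_ord k.
have -> : (k : nat) = m.-1 by have := ltn_ord k; lia.
by move=> _; rewrite (_ : (m.-1 + m).-1 = m - 2 + m) ?modnDr ?modn_small; lia.
Qed.

Lemma tgt_val k : (tgt k).2 = (if k.+1 < m then k.+1 else m.-1) :> nat.
Proof.
rewrite /tgt; case: ifP => /= hk; first by rewrite modn_small.
by have := ltn_ord k; lia.
Qed.

Lemma tgt_sign k : (tgt k).1 = ~~ (k.+1 < m).
Proof. by rewrite /tgt; case: ifP. Qed.

Lemma tgt_neq_src k : ((tgt k).2 == (src k).2) = false.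
Proof. by rewrite -val_eqE /= src_val tgt_val; case: ifP; lia. Qed.

Lemma bar_eq x y : (bar x == bar y) = (x == y).
Proof. exact: (inj_eq (can_inj barK)). Qed.

Lemma bar_eqC x y : (bar x == y) = (x == bar y).
Proof. by rewrite -[y in LHS]barK bar_eq. Qed.

Lemma bar_neq x : (bar x == x) = false.
Proof. by rewrite letter_eqE; case: x => [[]]. Qed.

Lemma src_tgtF k : (src k == tgt k) = false.
Proof. by apply/eqP => h; have := tgt_neq_src k; rewrite h eqxx. Qed.

Lemma src_bar_tgtF k : (src k == bar (tgt k)) = false.
Proof. by apply/eqP => h; have := tgt_neq_src k; rewrite h eqxx. Qed.

Lemma letter_arrowE k x y :
  letter_arrow k x y = (x == src k) && (y == tgt k) ||
                       (x == bar (tgt k)) && (y == bar (src k)).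
Proof.
rewrite !letter_eqE /= !src_val !tgt_val !tgt_sign.
case: x y => [[] [a ha]] [[] [c hc]]; have := ltn_ord k => /=;
by rewrite /letter_arrow -?val_eqE /=; case: ifP => /=; lia.
Qed.

Lemma letter_fE k x :
  letter_f k x = if x == src k then Some (tgt k)
                 else if x == bar (tgt k) then Some (bar (src k)) else None.
Proof.
rewrite /letter_f; case: pickP => [y | no_y]; last first.
  have := no_y (tgt k); have := no_y (bar (src k)); rewrite !letter_arrowE !eqxx.
  by rewrite !andbT; case: eqP => //= _ ->.
rewrite letter_arrowE => /orP[] /andP[/eqP-> /eqP->]; first by rewrite eqxx.
by rewrite eq_sym src_bar_tgtF eqxx.
Qed.

Lemma letter_eE k x :
  letter_e k x = if x == tgt k then Some (src k)
                 else if x == bar (src k) then Some (bar (tgt k)) else None.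
Proof.
rewrite /letter_e; case: pickP => [y | no_y]; last first.
  have := no_y (src k); have := no_y (bar (tgt k)); rewrite !letter_arrowE !eqxx /=.
  by rewrite [bar _ == src k]eq_sym src_bar_tgtF /= orbF => -> ->.
rewrite letter_arrowE => /orP[] /andP[/eqP-> /eqP->]; first by rewrite eqxx.
by rewrite bar_eqC src_bar_tgtF eqxx.
Qed.

Lemma letter_le_trans : transitive (@letter_le m).
Proof. by case=> [[] [a ha]] [[] [c hc]] [[] [d hd]] //=; lia. Qed.

Lemma letter_le_anti : antisymmetric (@letter_le m).
Proof.
move=> x y h; apply/eqP; move: h; rewrite letter_eqE.
by case: x y => [[] [a ha]] [[] [c hc]] //=; lia.
Qed.

Lemma letter_le_bar x y : letter_le (bar x) (bar y) = letter_le y x.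
Proof. by case: x y => [[] [a ha]] [[] [c hc]] //=; lia. Qed.

Lemma le_src_tgt k : letter_le (src k) (tgt k).
Proof.
have := src_val k; have := tgt_val k; rewrite /tgt /src.
by case: ifP => /= hk; lia.
Qed.

Lemma le_src_bar k : letter_le (src k) (bar (tgt k)).
Proof.
have := src_val k; have := tgt_val k; rewrite /tgt /src.
by case: ifP => /= hk; lia.
Qed.

Lemma bar_tgt_letF k : letter_le (bar (tgt k)) (tgt k) = false.
Proof. by rewrite /tgt; case: ifP => //= hk; have := ltn_ord k; lia. Qed.

(** The exception matters at the spin nodes, where [tgt k] and [bar (tgt k)] are m and \overline m
    in some order and hence incomparable. *)
Lemma le_tgt k z : letter_le (src k) z -> z != src k ->
  letter_le (tgt k) z || (z == bar (tgt k)).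
Proof.
rewrite !letter_eqE /= src_val tgt_val tgt_sign.
have := src_val k; have := tgt_val k; rewrite /tgt /src.
by case: z => [[] [a ha]] /=; case: ifP => /= hk; lia.
Qed.

Lemma le_bar_src k z : letter_le (bar (tgt k)) z -> z != bar (tgt k) ->
  letter_le (bar (src k)) z.
Proof.
rewrite !letter_eqE /= tgt_val tgt_sign.
have := src_val k; have := tgt_val k; rewrite /tgt /src.
by case: z => [[] [a ha]] /=; case: ifP => /= hk; lia.
Qed.

Lemma rank_inj : injective rank.
Proof.
move=> x y h; apply/eqP; rewrite letter_eqE; move: h.
by case: x y => [[] [a ha]] [[] [c hc]]; rewrite /rank /=; lia.
Qed.

Lemma rank_bar x : rank x + rank (bar x) = m.*2.-1.
Proof. by case: x => [[] [a ha]]; rewrite /rank /=; lia. Qed.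

Lemma rank_src_tgt k : rank (src k) < rank (tgt k).
Proof. by rewrite /rank src_val tgt_val tgt_sign; case: (ltnP k.+1 m) => /=; lia. Qed.

Lemma rank_bar_tgt_src k : rank (bar (tgt k)) < rank (bar (src k)).
Proof.
rewrite /rank /= src_val tgt_val tgt_sign; have := ltn_ord k.
by case: (ltnP k.+1 m) => /=; lia.
Qed.

Lemma letter_le_rank x y : rank x <= rank y ->
  letter_le x y || (x.2 == m.-1 :> nat) && (y == bar x).
Proof.
rewrite letter_eqE.
by case: x y => [[] [a ha]] [[] [c hc]]; rewrite /rank /=; lia.
Qed.

Lemma letter_le_antiF x y : letter_le x y -> x != y -> letter_le y x = false.
Proof.
move=> le_xy; apply: contraNF => le_yx.
by rewrite (letter_le_anti (introT andP (conj le_xy le_yx))).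
Qed.

(** * The signature rule on rows *)

Section Signature.

Variables (T : Type) (h : T -> letter m).

Definition sites x (s : seq T) := [seq p <- s | h p == x].

Lemma sites_nil a x s : all (fun p => letter_le a (h p)) s ->
  letter_le a x = false -> sites x s = [::].
Proof.
move=> le_a nle; rewrite /sites -(filter_pred0 s) -[in LHS](all_filterP le_a).
rewrite -!filter_predI; apply: eq_filter => p /=.
by case: eqP => //= ->; rewrite nle.
Qed.

(** In an increasing row the signs come in four blocks, + - + -. At a spin node the letters of the
    two middle blocks are incomparable, so one of these blocks is empty and their order does not
    matter. *)
Lemma signature_sorted k (s : seq T) : sorted (relpre h (@letter_le m)) s ->
  pmap (fun p => if letter_f k (h p) then Some (true, p)
                 else if letter_e k (h p) then Some (false, p) else None) s =
  map (pair true) (sites (src k) s) ++ map (pair false) (sites (tgt k) s) ++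
  map (pair true) (sites (bar (tgt k)) s) ++
  map (pair false) (sites (bar (src k)) s).
Proof.
have trT : transitive (relpre h (@letter_le m)).
  by move=> y x z; apply: letter_le_trans.
elim: s => //= p s IHs p_s; have le_p := order_path_min trT p_s.
rewrite {}IHs ?(path_sorted p_s) // letter_fE letter_eE.
have neq1 : tgt k == src k = false by rewrite eq_sym src_tgtF.
have neq2 : bar (tgt k) == src k = false by rewrite eq_sym src_bar_tgtF.
have neq3 : bar (src k) == tgt k = false by rewrite bar_eqC src_bar_tgtF.
have neq4 : tgt k == bar (tgt k) = false by rewrite eq_sym bar_neq.
have neq5 : src k == bar (src k) = false by rewrite eq_sym bar_neq.
have le1 := letter_le_antiF (le_src_tgt k) (negbT (src_tgtF k)).
have le2 := letter_le_antiF (le_src_bar k) (negbT (src_bar_tgtF k)).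
have le3 : letter_le (bar (src k)) (bar (tgt k)) = false by rewrite letter_le_bar.
have le4 : letter_le (bar (src k)) (tgt k) = false.
  by rewrite -[tgt k]barK letter_le_bar.
have le5 : letter_le (bar (src k)) (src k) = false.
  apply: contraFF le4 => le_bs; exact: letter_le_trans le_bs (le_src_tgt k).
have nil x : letter_le (h p) x = false -> sites x s = [::] by exact: sites_nil.
case: eqP => [hp | _]; first by rewrite hp src_tgtF src_bar_tgtF neq5.
case: (h p =P bar (tgt k)) => [hp | _].
  rewrite hp bar_neq bar_eq neq1 /= (nil (src k)) ?(nil (tgt k)) ?hp //.
  exact: bar_tgt_letF.
case: (h p =P tgt k) => [hp | _].
  by rewrite hp eq_sym neq3 /= (nil (src k)) ?hp.
case: (h p =P bar (src k)) => [hp | _] //=.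
by rewrite (nil (src k)) ?(nil (tgt k)) ?(nil (bar (tgt k))) ?hp.
Qed.

End Signature.

(** * Cancellation of signs *)

Section Stack.

Variable n : nat.
Implicit Types (s : seq 'I_n) (st : seq (bool * 'I_n)).

Lemma push_minus s st :
  foldl (@push_sign n) st (map (pair false) s) = map (pair false) (rev s) ++ st.
Proof.
elim: s st => //= p s IHs st; rewrite IHs rev_cons map_rcons -cats1 -catA.
by case: st.
Qed.

(** Pluses first consume the minuses on top; at most one of the two [drop]s is nonempty. Surplus
    pluses pile up because no minus lies deeper in the stack. *)
Lemma push_plus s u st : ~~ has (fun a => ~~ a.1) st ->
  foldl (@push_sign n) (map (pair false) u ++ st) (map (pair true) s) =
  map (pair false) (drop (size s) u) ++
  map (pair true) (rev (drop (size u) s)) ++ st.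
Proof.
elim: s u st => [|p s IHs] u st st_plus; first by rewrite drop0.
case: u => [|q u]; last by rewrite [LHS]IHs.
transitivity (foldl (@push_sign n) (map (pair false) [::] ++ (true, p) :: st)
                    (map (pair true) s)).
  by case: st st_plus => [|[[] r] st].
by rewrite IHs //= !drop0 rev_cons map_rcons cat_rcons.
Qed.

Lemma plus_plusE s : [seq a.2 | a <- map (pair true) s & a.1] = s.
Proof. by elim: s => //= p s ->. Qed.

Lemma minus_plusE s : [seq a.2 | a <- map (pair false) s & a.1] = [::].
Proof. by elim: s. Qed.

Lemma plus_minusE s : [seq a.2 | a <- map (pair true) s & ~~ a.1] = [::].
Proof. by elim: s. Qed.

Lemma minus_minusE s : [seq a.2 | a <- map (pair false) s & ~~ a.1] = s.
Proof. by elim: s => //= p s ->. Qed.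

Lemma ohead_rev_drop i s : i < size s -> ohead (rev (drop i s)) = ohead (rev s).
Proof.
move=> i_s; rewrite -[in RHS](cat_take_drop i s) rev_cat.
by case E: (rev (drop i s)) => //; move: (congr1 size E);
  rewrite size_rev size_drop /=; lia.
Qed.

Variables (k : 'I_m) (b : crow m n).

Let pos x := sites (tnth (val b)) x (enum 'I_n).

(** The first block of pluses has no minus on its left and the last block of minuses no plus on its
    right, so only the two middle blocks cancel. Comparing the counts of [tgt k] and [bar (tgt k)]
    thus decides which letter an operator changes. *)
Lemma uncancelledE : uncancelled k (val b) =
  rev (map (pair false) (rev (pos (bar (src k)))) ++
       map (pair false) (drop (size (pos (bar (tgt k)))) (rev (pos (tgt k)))) ++
       map (pair true) (rev (drop (size (pos (tgt k))) (pos (bar (tgt k))))) ++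
       map (pair true) (rev (pos (src k)))).
Proof.
rewrite /uncancelled /signature signature_sorted; last first.
  by rewrite -sorted_map map_tnth_enum; case: (b).
rewrite !foldl_cat.
have := @push_plus (pos (src k)) [::] [::] isT; rewrite /= !drop0 => ->.
rewrite !push_minus cats0 push_plus ?size_rev //.
by apply/hasPn => _ /mapP[p _ ->].
Qed.

Definition cnt x := count_mem x (val b).

Lemma size_pos x : size (pos x) = cnt x.
Proof.
by rewrite size_filter /cnt -[X in count_mem x X]map_tnth_enum [RHS]count_map.
Qed.

Lemma rightmost_plusE : rightmost_plus k (val b) =
  if cnt (tgt k) < cnt (bar (tgt k)) then ohead (rev (pos (bar (tgt k))))
  else ohead (rev (pos (src k))).
Proof.
rewrite /rightmost_plus uncancelledE filter_rev map_rev revK !filter_cat !map_cat.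
rewrite !minus_plusE !plus_plusE /=.
case: ltnP => lt_c.
  rewrite -(ohead_rev_drop (i := size (pos (tgt k)))) ?size_pos //.
  case E: (rev _) => //; move: (congr1 size E).
  by rewrite size_rev size_drop !size_pos /=; lia.
by rewrite drop_oversize ?size_pos.
Qed.

Lemma leftmost_minusE : leftmost_minus k (val b) =
  if cnt (bar (tgt k)) < cnt (tgt k) then ohead (pos (tgt k))
  else ohead (pos (bar (src k))).
Proof.
rewrite /leftmost_minus uncancelledE filter_rev map_rev !filter_cat !map_cat.
rewrite !minus_minusE !plus_minusE !cats0 drop_rev -rev_cat revK !size_pos.
case: ltnP => lt_c; last by rewrite (eqP lt_c) take0.
case E: (pos (tgt k)) => [|p s].
  by have := size_pos (tgt k); rewrite E /=; lia.
by rewrite -subn_gt0 in lt_c; case: (_ - _) lt_c.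
Qed.

End Stack.

(** * The crystal operators in terms of letter counts *)

Section Operators.

Variable n : nat.
Implicit Types (b : crow m n) (p q : 'I_n).

Lemma crow_le b p q : p < q -> letter_le (tnth (val b) p) (tnth (val b) q).
Proof.
move=> p_q; have x0 := tnth (val b) p; rewrite !(tnth_nth x0).
have: sorted (@letter_le m) (val b) by case: (b).
rewrite (sorted_pairwise letter_le_trans) => /(pairwiseP x0).
by apply; rewrite ?inE ?size_tuple.
Qed.

Lemma cnt_sum (t : n.-tuple (letter m)) x :
  count_mem x t = \sum_q (tnth t q == x).
Proof. by rewrite -sum1_count big_mkcond big_tuple. Qed.

Lemma cnt_gt0 b x : 0 < cnt b x -> exists q, tnth (val b) q = x.
Proof.
rewrite /cnt -has_count => /hasP[y y_b /eqP<-].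
by have /tnthP[q ->] := y_b; exists q.
Qed.

Lemma tnth_cnt_gt0 b q : 0 < cnt b (tnth (val b) q).
Proof.
rewrite /cnt -has_count; apply/hasP.
by exists (tnth (val b) q); rewrite ?mem_tnth /=.
Qed.

(** Letters of one row are comparable, and the reverse inequality never holds. This settles the
    exceptional case of [le_tgt]. *)
Lemma le_tgt_bar k b : 0 < cnt b (tgt k) -> 0 < cnt b (bar (tgt k)) ->
  letter_le (tgt k) (bar (tgt k)).
Proof.
move=> /cnt_gt0[q hq] /cnt_gt0[r hr]; case: (ltngtP q r) => [q_r | r_q | /val_inj q_r].
- by rewrite -hr -hq crow_le.
- by have := crow_le b r_q; rewrite hr hq bar_tgt_letF.
- by have := bar_neq (tgt k); rewrite -hr -hq q_r eqxx.
Qed.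

Lemma replace_row b p y :
    (forall q, q < p -> letter_le (tnth (val b) q) y) ->
    (forall q, p < q -> letter_le y (tnth (val b) q)) ->
  exists2 b' : crow m n, insub (replace_at (val b) p y) = Some b' &
    forall z, cnt b' z + (z == tnth (val b) p) = cnt b z + (z == y).
Proof.
move=> le_l le_r; set t := replace_at _ p y.
have t_sorted : sorted (@letter_le m) t.
  rewrite (sorted_pairwise letter_le_trans); apply/(pairwiseP y) => i j.
  rewrite !inE size_tuple => i_n j_n i_j.
  rewrite -(tnth_nth y t (Ordinal i_n)) -(tnth_nth y t (Ordinal j_n)).
  rewrite /t /replace_at !tnth_mktuple.
  case: eqP => [ip | _]; case: eqP => [jp | _].
  - by move: i_j; rewrite -[i]/(val (Ordinal i_n)) -[j]/(val (Ordinal j_n)) ip jp ltnn.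
  - by apply: le_r; rewrite -ip.
  - by apply: le_l; rewrite -jp.
  - exact: crow_le.
exists (Crow t_sorted) => [|z].
  by rewrite insubT.
rewrite -[cnt (Crow _) z]/(count_mem z t) /cnt !cnt_sum (bigD1 p) //= [in RHS](bigD1 p) //=.
rewrite /t /replace_at tnth_mktuple eqxx.
rewrite (eq_bigr (fun q => (tnth (val b) q == z) : nat)); last first.
  by move=> q /negbTE q_p; rewrite tnth_mktuple q_p.
by rewrite [y == z]eq_sym [tnth _ p == z]eq_sym /=; lia.
Qed.

Lemma ohead_sites b x p : ohead (sites (tnth (val b)) x (enum 'I_n)) = Some p ->
  tnth (val b) p = x /\ forall q, q < p -> tnth (val b) q != x.
Proof.
have : sorted (relpre val ltn) (enum 'I_n).
  by rewrite -sorted_map val_enum_ord iota_ltn_sorted.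
have tr : transitive (relpre (val : 'I_n -> nat) ltn).
  by move=> ? ? ?; apply: ltn_trans.
move=> /(sorted_filter tr (fun p => tnth (val b) p == x)).
rewrite -/(sites _ x _); case E: (sites _ _ _) => [|r s] //= r_s [<-{p}].
have: r \in sites (tnth (val b)) x (enum 'I_n) by rewrite E mem_head.
rewrite mem_filter => /andP[/eqP-> _]; split=> // q q_r; apply: contraTneq q_r => hq.
have: q \in sites (tnth (val b)) x (enum 'I_n).
  by rewrite mem_filter hq eqxx mem_enum.
rewrite E inE => /predU1P[-> | q_s]; first by rewrite ltnn.
by have /allP/(_ q q_s) := order_path_min tr r_s; rewrite -leqNgt => /ltnW.
Qed.

Lemma ohead_rev_sites b x p :
    ohead (rev (sites (tnth (val b)) x (enum 'I_n))) = Some p ->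
  tnth (val b) p = x /\ forall q, p < q -> tnth (val b) q != x.
Proof.
have : sorted (relpre val ltn) (enum 'I_n).
  by rewrite -sorted_map val_enum_ord iota_ltn_sorted.
have tr : transitive (relpre (val : 'I_n -> nat) ltn).
  by move=> ? ? ?; apply: ltn_trans.
move=> /(sorted_filter tr (fun p => tnth (val b) p == x)).
rewrite -/(sites _ x _) -[X in sorted _ X]revK.
case E: (rev (sites _ _ _)) => [|r s] //=; rewrite rev_sorted /= => r_s [<-{p}].
have trr : transitive (fun z : 'I_n => (relpre val ltn)^~ z).
  by move=> ? ? ? /= h1 h2; apply: ltn_trans h2 h1.
have: r \in rev (sites (tnth (val b)) x (enum 'I_n)) by rewrite E mem_head.
rewrite mem_rev mem_filter => /andP[/eqP-> _]; split=> // q q_r.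
apply: contraTneq q_r => hq.
have: q \in rev (sites (tnth (val b)) x (enum 'I_n)).
  by rewrite mem_rev mem_filter hq eqxx mem_enum.
rewrite E inE => /predU1P[-> | q_s]; first by rewrite ltnn.
by have /allP/(_ q q_s) := order_path_min trr r_s; rewrite -leqNgt => /ltnW.
Qed.

Lemma ohead_sites_ex b x s : perm_eq s (sites (tnth (val b)) x (enum 'I_n)) ->
  0 < cnt b x -> exists p, ohead s = Some p.
Proof.
by case: s => [|p s] /perm_size; rewrite size_pos; [move=> <- | exists p].
Qed.

Lemma ohead_sites_nil b x s : perm_eq s (sites (tnth (val b)) x (enum 'I_n)) ->
  cnt b x = 0 -> s = [::].
Proof.
by case: s => [|p s] /perm_size; rewrite size_pos // => <-.
Qed.

(* The equations on counts say that one letter is replaced by another; they are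
   additive to keep away from truncated subtraction. *)
Variant row_f_spec k b : option (crow m n) -> Prop :=
| RowFNone of cnt b (bar (tgt k)) <= cnt b (tgt k) & cnt b (src k) = 0 :
    row_f_spec k b None
| RowFBar b' of cnt b (tgt k) < cnt b (bar (tgt k)) &
    (forall z, cnt b' z + (z == bar (tgt k)) = cnt b z + (z == bar (src k))) :
    row_f_spec k b (Some b')
| RowFSrc b' of cnt b (bar (tgt k)) <= cnt b (tgt k) & 0 < cnt b (src k) &
    (forall z, cnt b' z + (z == src k) = cnt b z + (z == tgt k)) :
    row_f_spec k b (Some b').

Variant row_e_spec k b : option (crow m n) -> Prop :=
| RowENone of cnt b (tgt k) <= cnt b (bar (tgt k)) & cnt b (bar (src k)) = 0 :
    row_e_spec k b None
| RowETgt b' of cnt b (bar (tgt k)) < cnt b (tgt k) &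
    (forall z, cnt b' z + (z == tgt k) = cnt b z + (z == src k)) :
    row_e_spec k b (Some b')
| RowEBar b' of cnt b (tgt k) <= cnt b (bar (tgt k)) & 0 < cnt b (bar (src k)) &
    (forall z, cnt b' z + (z == bar (src k)) = cnt b z + (z == bar (tgt k))) :
    row_e_spec k b (Some b').

Lemma row_fP k b : row_f_spec k b (row_f k b).
Proof.
rewrite /row_f /word_f rightmost_plusE; case: ltnP => lt_c.
  case: (@ohead_sites_ex b (bar (tgt k))
           (rev (sites (tnth (val b)) (bar (tgt k)) (enum 'I_n)))).
  - by rewrite perm_rev.
  - exact: leq_ltn_trans lt_c.
  move=> p p_eq; rewrite p_eq /=; have [hp last_p] := ohead_rev_sites p_eq.
  rewrite letter_fE hp [_ == src k]eq_sym src_bar_tgtF eqxx /=.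
  have le_y : letter_le (bar (tgt k)) (bar (src k)).
    by rewrite letter_le_bar le_src_tgt.
  case: (@replace_row b p (bar (src k))) => [q q_p | q p_q | b' -> hb'] /=.
  - by apply: letter_le_trans le_y; rewrite -hp crow_le.
  - by apply: le_bar_src (last_p q p_q); rewrite -hp crow_le.
  - by apply: RowFBar => // z; rewrite -hp.
case: (posnP (cnt b (src k))) => c_src.
  rewrite (@ohead_sites_nil b (src k)
             (rev (sites (tnth (val b)) (src k) (enum 'I_n)))) ?perm_rev //.
  exact: RowFNone.
case: (@ohead_sites_ex b (src k)
         (rev (sites (tnth (val b)) (src k) (enum 'I_n)))) => //.
  by rewrite perm_rev.
move=> p p_eq; rewrite p_eq /=; have [hp last_p] := ohead_rev_sites p_eq.
rewrite letter_fE hp eqxx /=.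
case: (@replace_row b p (tgt k)) => [q q_p | q p_q | b' -> hb'] /=.
- by apply: letter_le_trans (le_src_tgt k); rewrite -hp crow_le.
(* If a [bar (tgt k)] follows, [lt_c] forces a [tgt k] into the row as well, so the two letters are
   comparable. *)
- have := crow_le b p_q.
  rewrite hp => /le_tgt/(_ (last_p q p_q))/orP[//| /eqP hq].
  have c_bar := tnth_cnt_gt0 b q; rewrite hq in c_bar *.
  by apply: le_tgt_bar (c_bar); apply: leq_trans lt_c.
- by apply: RowFSrc => // z; rewrite -hp.
Qed.

Lemma row_eP k b : row_e_spec k b (row_e k b).
Proof.
rewrite /row_e /word_e leftmost_minusE; case: ltnP => lt_c.
  case: (@ohead_sites_ex b (tgt k) _ (perm_refl _)) => [|p p_eq].
    exact: leq_ltn_trans lt_c.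
  rewrite p_eq /=; have [hp first_p] := ohead_sites p_eq.
  rewrite letter_eE hp eqxx /=.
  case: (@replace_row b p (src k)) => [q q_p | q p_q | b' -> hb'] /=.
  - rewrite -letter_le_bar; apply: le_bar_src; last by rewrite bar_eq first_p.
    by rewrite letter_le_bar -hp crow_le.
  - by apply: letter_le_trans (le_src_tgt k) _; rewrite -hp crow_le.
  - by apply: RowETgt => // z; rewrite -hp.
case: (posnP (cnt b (bar (src k)))) => c_src.
  by rewrite (ohead_sites_nil (perm_refl _) c_src); apply: RowENone.
case: (ohead_sites_ex (perm_refl _) c_src) => p p_eq.
rewrite p_eq /=; have [hp first_p] := ohead_sites p_eq.
rewrite letter_eE hp bar_eqC src_bar_tgtF eqxx /=.
have le_y : letter_le (bar (tgt k)) (bar (src k)).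
  by rewrite letter_le_bar le_src_tgt.
case: (@replace_row b p (bar (tgt k))) => [q q_p | q p_q | b' -> hb'] /=.
- have := @le_tgt k (bar (tnth (val b) q)).
  rewrite -letter_le_bar barK -hp crow_le // bar_eqC first_p // => /(_ isT isT).
  rewrite bar_eq -letter_le_bar barK => /orP[//| /eqP hq].
  have c_tgt := tnth_cnt_gt0 b q; rewrite hq in c_tgt *.
  by apply: le_tgt_bar (c_tgt) _; apply: leq_trans lt_c.
- by apply: letter_le_trans le_y _; rewrite -hp crow_le.
- by apply: RowEBar => // z; rewrite -hp.
Qed.

End Operators.
(** * Rows as letter counts *)

Section Rows.

Variable n : nat.
Implicit Types (b : crow m n).

Lemma cnt_inj b b' : cnt b =1 cnt b' -> b = b'.
Proof.
move=> eq_cnt; apply/val_inj/val_inj.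
apply: (sorted_eq letter_le_trans letter_le_anti); [by case: (b) | by case: (b') |].
by apply/allP => x _; apply/eqP/eq_cnt.
Qed.

Lemma cnt_middle b x : x.2 = m.-1 :> nat -> minn (cnt b x) (cnt b (bar x)) = 0.
Proof.
move=> x_mid; have nle y : y.2 = m.-1 :> nat -> letter_le y (bar y) = false.
  by case: y => [[] [a ha]] //=; lia.
case: (posnP (cnt b x)) => [-> | /cnt_gt0[q hq]]; first by rewrite min0n.
case: (posnP (cnt b (bar x))) => [-> | /cnt_gt0[r hr]]; first by rewrite minn0.
case: (ltngtP q r) => [/(crow_le b) | /(crow_le b) | /val_inj q_r].
- by rewrite hq hr nle.
- by rewrite hq hr -[x in letter_le _ x]barK nle.
- by have := bar_neq x; rewrite -hr -hq q_r eqxx.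
Qed.

Lemma sum_cnt b : \sum_x cnt b x = n.
Proof.
under eq_bigr do rewrite /cnt cnt_sum.
rewrite exchange_big /= -[RHS]card_ord -sum1_card; apply: eq_bigr => q _.
rewrite (bigD1 (tnth (val b) q)) //= eqxx big1 // => x.
by rewrite eq_sym => /negbTE->.
Qed.

(** Listing each letter x with multiplicity [g x] and sorting by [rank] gives a row: [rank] departs
    from the letter order only on the pair m, \overline m, and these do not both occur. *)
Lemma row_of_counts (g : letter m -> nat) : \sum_x g x = n ->
    (forall x, x.2 = m.-1 :> nat -> minn (g x) (g (bar x)) = 0) ->
  exists b, cnt b =1 g.
Proof.
move=> sum_g g_mid.
pose s := sort (relpre rank leq) (flatten [seq nseq (g x) x | x <- index_enum (letter m)]).
have cnt_s x : count_mem x s = g x.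
  rewrite (permP (permEl (perm_sort _ _))) count_flatten sumnE !big_map.
  rewrite (bigD1 x) //= count_nseq /= eqxx mul1n big1 ?addn0 // => y /negbTE y_x.
  by rewrite count_nseq /= y_x.
have size_s : size s == n.
  rewrite size_sort size_flatten sumnE !big_map -sum_g.
  by apply/eqP; apply: eq_bigr => x _; rewrite size_nseq.
have s_sorted : sorted (@letter_le m) (Tuple size_s).
  apply: (@sub_in_sorted _ [pred x | 0 < g x] (relpre rank leq)).
  - move=> x y gx gy /letter_le_rank/orP[] // /andP[/eqP/g_mid + /eqP y_x].
    have {}gx : 0 < g x := gx; have {gy} : 0 < g y := gy.
    by rewrite y_x; lia.
  - apply/allP => x; rewrite /= mem_sort => /flattenP[_ /mapP[y _ ->]].
    by rewrite mem_nseq => /andP[gy /eqP->].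
  - by apply: sort_sorted => x y; exact: leq_total.
by exists (Crow s_sorted) => x; apply: cnt_s.
Qed.

Local Open Scope ring_scope.

(* A vector seen as an odd function on letters, so that the Weyl group acts by
   permuting letters. *)
Definition coord (v : 'cV[int]_m) x : int := (-1) ^+ x.1 * v x.2 ord0.

Lemma coord_bar v x : coord v (bar x) = - coord v x.
Proof. by rewrite /coord /=; case: x.1; rewrite /= ?expr0 ?expr1 !mulNr ?opprK. Qed.

Lemma coord_inj v v' : coord v =1 coord v' -> v = v'.
Proof.
move=> eq_v; apply/matrixP => i j; rewrite ord1.
by have := eq_v (false, i); rewrite /coord /= !mul1r.
Qed.

Lemma coord_wt b x : coord (row_wt b) x = (cnt b x)%:Z - (cnt b (bar x))%:Z.
Proof.
rewrite /cnt !cnt_sum /coord /row_wt summxE mulr_sumr.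
rewrite (big_morph Posz PoszD (erefl 0%Z)) (big_morph Posz PoszD (erefl 0%Z)).
rewrite -sumrB; apply: eq_bigr => q _; rewrite /letter_wt !mxE eqxx andbT.
rewrite !letter_eqE /= -[_ == _ :> nat]/(_ == _ :> 'I_m).
case: (tnth _ q) => s a; case: x => t c /=; rewrite [c == a]eq_sym.
by case: s t (a == c) => [] [] [].
Qed.

Lemma row_eq b b' :
    (forall x, minn (cnt b x) (cnt b (bar x)) = minn (cnt b' x) (cnt b' (bar x))) ->
  row_wt b = row_wt b' -> b = b'.
Proof.
move=> eq_min eq_wt; apply: cnt_inj => x.
have := eq_min x; have := coord_wt b x; rewrite eq_wt coord_wt; lia.
Qed.

Local Close Scope ring_scope.

(* On the pairs of counts of i and \bar i, act keeps the minimum and moves the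
   difference, i.e. the weight, by the signed permutation w. *)
Definition act (w : letter m -> letter m) b : crow m n :=
  odflt b [pick b' | [forall x, cnt b' x ==
    minn (cnt b x) (cnt b (bar x)) + (cnt b (w x) - cnt b (bar (w x)))]].

Section Act.

Variable w : letter m -> letter m.
Hypotheses (wK : involutive w) (w_bar : forall x, w (bar x) = bar (w x)).

(** The [pick] in [act] never fails. Reindexing the second summand by [w] shows that the prescribed
    counts add up to n, and at the middle index their minimum is 0 because t_m = 0. *)
Lemma cnt_act b x : cnt (act w b) x =
  minn (cnt b x) (cnt b (bar x)) + (cnt b (w x) - cnt b (bar (w x))).
Proof.
rewrite /act; case: pickP => [b' /forallP/(_ x)/eqP // | no_b'].
pose g x := minn (cnt b x) (cnt b (bar x)) + (cnt b (w x) - cnt b (bar (w x))).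
have [| y y_mid | b' hb'] := @row_of_counts g.
- rewrite big_split /= [X in _ + X = _](reindex_inj (inv_inj wK)) -big_split /=.
  rewrite -[RHS](sum_cnt b); apply: eq_bigr => y _; rewrite wK; lia.
- by rewrite /g !cnt_middle /= ?w_bar ?barK; lia.
by have /forallP[] := no_b' b'; move=> y; rewrite hb'.
Qed.

Lemma min_act b x : minn (cnt (act w b) x) (cnt (act w b) (bar x)) =
  minn (cnt b x) (cnt b (bar x)).
Proof. by rewrite !cnt_act w_bar !barK; lia. Qed.

Lemma coord_wt_act b x : coord (row_wt (act w b)) x = coord (row_wt b) (w x).
Proof. by rewrite !coord_wt !cnt_act w_bar !barK; lia. Qed.

Lemma actK : involutive (act w).
Proof.
move=> b; apply: row_eq => [x | ]; first by rewrite !min_act.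
by apply: coord_inj => x; rewrite !coord_wt_act wK.
Qed.

End Act.

End Rows.

(** * Simple reflections as permutations of letters *)

Definition swap k x : letter m :=
  if x == src k then tgt k else if x == tgt k then src k else
  if x == bar (src k) then bar (tgt k) else if x == bar (tgt k) then bar (src k)
  else x.

Lemma swapK k : involutive (swap k).
Proof.
move=> x; rewrite /swap.
have neq := (src_tgtF k, src_bar_tgtF k, bar_neq (src k), bar_neq (tgt k)).
case: (eqVneq x (src k)) => [-> | /negbTE n1].
  by rewrite [tgt k == src k]eq_sym neq eqxx.
case: (eqVneq x (tgt k)) => [-> | /negbTE n2]; first by rewrite eqxx.
case: (eqVneq x (bar (src k))) => [-> | /negbTE n3].
  rewrite [bar (tgt k) == src k]eq_sym neq neq bar_eq [tgt k == src k]eq_sym neq.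
  by rewrite eqxx.
case: (eqVneq x (bar (tgt k))) => [-> | /negbTE n4]; last by rewrite n1 n2 n3 n4.
by rewrite neq bar_eqC src_bar_tgtF eqxx.
Qed.

Lemma swap_src k : swap k (src k) = tgt k.
Proof. by rewrite /swap eqxx. Qed.

Lemma swap_tgt k : swap k (tgt k) = src k.
Proof. by rewrite -swap_src swapK. Qed.

Lemma swap_bar k x : swap k (bar x) = bar (swap k x).
Proof.
rewrite /swap !(bar_eqC x) !barK.
have neq := (src_tgtF k, src_bar_tgtF k, bar_neq (src k), bar_neq (tgt k)).
case: (eqVneq x (src k)) => [-> | /negbTE n1].
  by rewrite [src k == bar (src k)]eq_sym !neq.
case: (eqVneq x (tgt k)) => [-> | /negbTE n2].
  by rewrite [tgt k == bar _]eq_sym bar_eqC src_bar_tgtF [tgt k == bar _]eq_sym neq.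
case: (eqVneq x (bar (src k))) => [_ | _]; first by rewrite barK.
by case: (eqVneq x (bar (tgt k))); rewrite ?barK.
Qed.

Local Open Scope ring_scope.

Lemma simple_rootE k i : simple_root k i ord0 =
  (i == (src k).2)%:R - (-1) ^+ (tgt k).1 * (i == (tgt k).2)%:R.
Proof.
rewrite mxE -!val_eqE /= src_val tgt_val tgt_sign; have := ltn_ord k.
have := ltn_ord i; case: ifP => /= hk i_m k_m; first by rewrite mul1r.
rewrite expr1 mulN1r opprK; congr (_%:R + _%:R); apply/eqP; lia.
Qed.

Lemma coord_simple_root k v :
  ((simple_root k)^T *m v) ord0 ord0 = coord v (src k) - coord v (tgt k).
Proof.
rewrite mxE /coord /= mul1r; under eq_bigr do rewrite mxE simple_rootE mulrBl.
rewrite sumrB; congr (_ - _).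
  rewrite (bigD1 (src k).2) //= eqxx mul1r big1 ?addr0 // => i /negbTE->.
  by rewrite mul0r.
rewrite (bigD1 (tgt k).2) //= eqxx mulr1 big1 ?addr0 // => i /negbTE->.
by rewrite mulr0 mul0r.
Qed.

Lemma coord_simple_rootE k x : coord (simple_root k) x =
  (x == src k)%:R - (x == bar (src k))%:R - (x == tgt k)%:R + (x == bar (tgt k))%:R.
Proof.
rewrite /coord simple_rootE !letter_eqE /= -![_ == _ :> nat]/(_ == _ :> 'I_m).
by case: x.1; case: (tgt k).1; case: (_ == _); case: (_ == _).
Qed.

Lemma coord_simple_refl k v x : coord (simple_refl k *m v) x = coord v (swap k x).
Proof.
have -> : coord (simple_refl k *m v) x =
    coord v x - coord (simple_root k) x * (coord v (src k) - coord v (tgt k)).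
  rewrite -coord_simple_root /simple_refl mulmxBl mul1mx -mulmxA /coord !mxE.
  by rewrite big_ord1 mulrBr mulrA !mxE.
rewrite coord_simple_rootE /swap.
have neq := (src_tgtF k, src_bar_tgtF k, bar_neq (src k), bar_neq (tgt k)).
case: (eqVneq x (src k)) => [-> | /negbTE n1].
  by rewrite [src k == bar (src k)]eq_sym !neq; lia.
case: (eqVneq x (tgt k)) => [-> | /negbTE n2].
  by rewrite [tgt k == bar _]eq_sym bar_eqC src_bar_tgtF [tgt k == bar _]eq_sym neq; lia.
case: (eqVneq x (bar (src k))) => [-> | /negbTE n3].
  by rewrite bar_eq src_tgtF !coord_bar; lia.
by case: (eqVneq x (bar (tgt k))) => [-> | /negbTE n4]; rewrite ?coord_bar; lia.
Qed.

Local Close Scope ring_scope.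
Lemma node_neqE k :
  ((src k == tgt k = false) * (tgt k == src k = false) *
   (src k == bar (tgt k) = false) * (bar (tgt k) == src k = false) *
   (bar (src k) == tgt k = false) * (tgt k == bar (src k) = false) *
   (bar (src k) == bar (tgt k) = false) * (bar (tgt k) == bar (src k) = false) *
   (bar (src k) == src k = false) * (src k == bar (src k) = false) *
   (bar (tgt k) == tgt k = false) * (tgt k == bar (tgt k) = false))%type.
Proof.
have n1 := src_tgtF k; have n2 := src_bar_tgtF k.
have n3 : bar (src k) == tgt k = false by rewrite bar_eqC.
by do !split; rewrite ?bar_eq ?bar_neq ?n1 ?n2 ?n3 // eq_sym ?bar_neq ?n1 ?n2 ?n3.
Qed.

(** Evaluates count equations at the four letters met by k-arrows, which leaves linear
    arithmetic. *)
Ltac counts_at k H := move: (H (src k)) (H (tgt k)) (H (bar (src k)))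
  (H (bar (tgt k))); rewrite !eqxx !(node_neqE k) ?barK /=.

(** * Uniqueness of cactus maps *)

Section Cactus.

Variable n : nat.
Implicit Types (b : crow m n) (J : {set 'I_m}).

Lemma row_eK k b b' : row_e k b = Some b' -> row_f k b' = Some b.
Proof.
case: row_eP => // c hc => [|hc'] hcnt [<-{b'}]; counts_at k hcnt => h1 h2 h3 h4.
  case: row_fP => [||d _ _ hd]; [lia | lia |].
  by congr Some; apply: cnt_inj => z; have := hcnt z; have := hd z; lia.
case: row_fP => [|d _ hd|]; [lia | | lia].
by congr Some; apply: cnt_inj => z; have := hcnt z; have := hd z; lia.
Qed.

Lemma row_fK k b b' : row_f k b = Some b' -> row_e k b' = Some b.
Proof.
case: row_fP => // c hc => [|hc'] hcnt [<-{b'}]; counts_at k hcnt => h1 h2 h3 h4.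
  case: row_eP => [||d _ _ hd]; [lia | lia |].
  by congr Some; apply: cnt_inj => z; have := hcnt z; have := hd z; lia.
case: row_eP => [|d _ hd|]; [lia | | lia].
by congr Some; apply: cnt_inj => z; have := hcnt z; have := hd z; lia.
Qed.

Lemma sum_move (r : letter m -> nat) b b' x y :
    (forall z, cnt b' z + (z == x) = cnt b z + (z == y)) ->
  \sum_z cnt b' z * r z + r x = \sum_z cnt b z * r z + r y.
Proof.
have delta a : r a = \sum_z (z == a) * r z.
  by rewrite (bigD1 a) //= eqxx mul1n big1 ?addn0 // => z /negbTE->.
move=> hcnt; rewrite (delta x) (delta y) -!big_split /=.
by apply: eq_bigr => z _; rewrite -!mulnDl hcnt.
Qed.

(** Well-founded because every [row_e k] lowers the sum of the ranks of the letters; [row_f_ind]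
    measures with the ranks of the barred letters instead. *)
Lemma row_e_ind (P : crow m n -> Prop) :
    (forall b, (forall k b', row_e k b = Some b' -> P b') -> P b) ->
  forall b, P b.
Proof.
move=> step b; have [h] := ubnP (\sum_z cnt b z * rank z).
elim: h b => // h IHh b lt_h; apply: step => k b'.
case: row_eP => // c hc => [|hc'] hcnt [<-{b'}]; apply: IHh;
  have := sum_move rank hcnt; have := rank_src_tgt k; have := rank_bar_tgt_src k; lia.
Qed.

Lemma row_f_ind (P : crow m n -> Prop) :
    (forall b, (forall k b', row_f k b = Some b' -> P b') -> P b) ->
  forall b, P b.
Proof.
move=> step b; have [h] := ubnP (\sum_z cnt b z * rank (bar z)).
elim: h b => // h IHh b lt_h; apply: step => k b'.
have := rank_bar_tgt_src k; have := rank_src_tgt k.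
case: row_fP => // c hc => [|hc'] hcnt h1 h2 [<-{b'}]; apply: IHh;
  have := sum_move (fun z => rank (bar z)) hcnt; rewrite /= ?barK;
  set S := \sum_z cnt b z * _ in lt_h *; lia.
Qed.

Section Component.

Variable J : {set 'I_m}.

(* inv separates the J-components of the crystal. *)
Variable inv : crow m n -> letter m -> nat.
Hypothesis inv_e : forall k b b', k \in J -> row_e k b = Some b' -> inv b' =1 inv b.
Hypothesis highest_unique : forall b b', inv b =1 inv b' ->
  (forall k, k \in J -> row_e k b = None) ->
  (forall k, k \in J -> row_e k b' = None) -> b = b'.
Hypothesis theta_in : forall k, k \in J -> theta J k \in J.
Hypothesis thetaK : forall k, k \in J -> theta J (theta J k) = k.

Lemma edge_inv b b' : crystal_edge J b b' -> inv b' =1 inv b.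
Proof.
move=> /exists_inP[k kJ] /orP[] /eqP; first by move=> /row_fK/inv_e h x; rewrite h.
by move=> /row_fK/inv_e h x; rewrite h.
Qed.

Lemma connect_inv b b' : connect (crystal_edge J) b b' -> inv b' =1 inv b.
Proof.
move=> /connectP[s]; elim: s b => [|c s IHs] b /=; first by move=> _ ->.
by move=> /andP[/edge_inv b_c c_s] b'E x; rewrite (IHs c) // b_c.
Qed.

Lemma edge_sym : symmetric (@crystal_edge m n J).
Proof. by move=> b b'; apply: eq_existsb => k; rewrite orbC. Qed.

Lemma row_e_edge k b b' : k \in J -> row_e k b = Some b' -> crystal_edge J b b'.
Proof.
by move=> kJ /row_eK b_b'; apply/exists_inP; exists k; rewrite // b_b' eqxx orbT.
Qed.

Lemma highest_connect b : exists2 u, connect (crystal_edge J) b u &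
  forall k, k \in J -> row_e k u = None.
Proof.
elim/row_e_ind: b => b IHb.
case: (pickP [pred k in J | row_e k b]) => [k /andP[kJ] | highest_b].
  case E: (row_e k b) => [c|] // _; have [u c_u highest_u] := IHb _ _ E.
  by exists u => //; apply: connect_trans c_u; apply/connect1/(row_e_edge kJ E).
exists b => // k kJ; have := highest_b k; rewrite /= kJ /=.
by case: (row_e k b).
Qed.

Lemma inv_connect b b' : inv b =1 inv b' -> connect (crystal_edge J) b b'.
Proof.
move=> eq_inv; have [u b_u highest_u] := highest_connect b.
have [u' b_u' highest_u'] := highest_connect b'.
have u_u' : u = u'.
  by apply: highest_unique => // x; rewrite (connect_inv b_u) (connect_inv b_u').
rewrite (connect_trans b_u) // u_u' (sym_connect_sym edge_sym) //.
Qed.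

(** If f_k b = d with k in J, the e-clause at theta(k) reads e_{theta(k)} (c b) = c d, and e is
    injective where defined, so the value at d determines the value at b. If b is J-lowest, both
    images are J-highest rows of its component. *)
Lemma is_cactus_unique (c c' : crow m n -> crow m n) :
  is_cactus J c -> is_cactus J c' -> c =1 c'.
Proof.
move=> [conn _ c_e _] [conn' _ c_e' _]; elim/row_f_ind => b IHb.
case: (pickP [pred k in J | row_f k b]) => [k /andP[kJ] | lowest_b].
  case E: (row_f k b) => [d|] // _.
  have := c_e' _ b (theta_in kJ); have := c_e _ b (theta_in kJ).
  rewrite thetaK // E /=.
  have := c_e _ d; have := c_e' _ d.
  rewrite (IHb _ _ E) => _ _ /row_eK + /row_eK; by move=> -> [->].
have lowest k : k \in J -> row_f k b = None.
  by move=> kJ; have := lowest_b k; rewrite /= kJ; case: (row_f k b).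
apply: highest_unique => [x | k kJ | k kJ].
- by rewrite (connect_inv (conn b)) (connect_inv (conn' b)).
- by rewrite c_e // lowest ?theta_in.
- by rewrite c_e' // lowest ?theta_in.
Qed.

Variable w : letter m -> letter m.
Hypotheses (wK : involutive w) (w_bar : forall x, w (bar x) = bar (w x)).
Hypothesis longest_w : forall v x, coord (longest J *m v)%R x = coord v (w x).
Hypothesis inv_act : forall b, inv (act w b) =1 inv b.
Hypothesis act_e : forall k b, k \in J ->
  row_e k (act w b) = omap (act w) (row_f (theta J k) b).

(** The candidate satisfies the axioms, which makes [epsilon_spec] applicable, and uniqueness
    concludes. The f-clause follows from the e-clause because [act w] is an involution. *)
Lemma cactusE : @cactus m n J =1 act w.
Proof.
have act_cactus : is_cactus J (@act n w).
  split=> [b | b | | k b kJ]; last first.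
  - have := act_e (act w b) (theta_in kJ); rewrite actK // thetaK // => ->.
    by case: (row_f k _) => //= c; rewrite actK.
  - by move=> k b; apply: act_e.
  - by apply: coord_inj => x; rewrite coord_wt_act // longest_w.
  - by apply: inv_connect => x; rewrite inv_act.
apply: (is_cactus_unique _ act_cactus).
exact: (epsilon_spec (inhabits id) (is_cactus J) (ex_intro _ _ act_cactus)).
Qed.

End Component.

End Cactus.
(** * Lengths and longest elements in type D *)

Section Weyl.

Local Open Scope ring_scope.

Implicit Types (w : seq 'I_m) (v : 'cV[int]_m) (J : {set 'I_m}).

(* Twice the half sum of the positive roots, shifted by (1, ..., 1) so that no
   two letters pair equally with it. *)
Definition rho : 'cV[int]_m := \col_i ((m.*2.-1)%:Z - (i.*2)%:Z).

Lemma coord_rho x : coord rho x = (m.*2.-1)%:Z - ((rank x).*2)%:Z.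
Proof. by rewrite /coord mxE /rank; case: x => [[] [a ha]] /=; lia. Qed.

(** The first letter of [w] acts first on x, since reflections act on functions of letters by
    precomposition. *)
Definition word_perm w x := foldl (fun y k => swap k y) x w.

Lemma coord_word w v x : coord (weyl_word w *m v) x = coord v (word_perm w x).
Proof.
elim: w x => [|k w IHw] x; first by rewrite /weyl_word big_nil mul1mx.
by rewrite /weyl_word big_cons -mulmxA coord_simple_refl IHw.
Qed.

Lemma swap_inj k : injective (swap k).
Proof. exact: inv_inj (swapK k). Qed.

Lemma word_perm_inj w : injective (word_perm w).
Proof. by elim: w => //= k w IHw x y /IHw/swap_inj. Qed.

Lemma coord_rho_inj : injective (coord rho).
Proof. by move=> x y; rewrite !coord_rho => h; apply: rank_inj; lia. Qed.

Lemma weyl_word_cons k w v :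
  weyl_word (k :: w) *m v = simple_refl k *m (weyl_word w *m v).
Proof. by rewrite /weyl_word big_cons mulmxA. Qed.

Lemma simple_reflK k v : simple_refl k *m (simple_refl k *m v) = v.
Proof. by apply: coord_inj => x; rewrite !coord_simple_refl swapK. Qed.

Lemma mulmx_col_inj (g h : 'M[int]_m) : (forall v, g *m v = h *m v) -> g = h.
Proof.
move=> eq_gh; apply/matrixP => i j.
have /matrixP/(_ i ord0) := eq_gh (delta_mx j ord0).
by rewrite -!colE !mxE.
Qed.

Definition inv_set v : {set letter m * letter m} :=
  [set p | [&& p.1.2 != p.2.2, (rank p.1 < rank p.2)%N &
               coord v p.1 < coord v p.2]].

(* Each positive root sent to a negative one is counted twice, as (x, y) and as
   (bar y, bar x). *)
Definition len v := #|inv_set v|.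

Lemma letter_eq_rank x y : (x == y) = (rank x == rank y).
Proof. by rewrite (inj_eq rank_inj). Qed.

Lemma rank_src k : rank (src k) = if (k.+1 < m)%N then k : nat else (m - 2)%N.
Proof. by rewrite /rank src_val. Qed.

Lemma rank_tgt k : rank (tgt k) = if (k.+1 < m)%N then k.+1 else m.
Proof.
by rewrite /rank tgt_val tgt_sign; have := ltn_ord k; case: (ltnP k.+1 m) => /=; lia.
Qed.

Lemma index_eq_rank x y :
  (x.2 == y.2) = (rank x == rank y) || (rank x + rank y == m.*2.-1)%N.
Proof.
by case: x y => [[] [a ha]] [[] [c hc]]; rewrite /rank -val_eqE /=; lia.
Qed.

Lemma rank_barE x : rank (bar x) = (m.*2.-1 - rank x)%N.
Proof. by have := rank_bar x; lia. Qed.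

Lemma rank_swapE k x : rank (swap k x) =
  if rank x == rank (src k) then rank (tgt k) else
  if rank x == rank (tgt k) then rank (src k) else
  if rank x == rank (bar (src k)) then rank (bar (tgt k)) else
  if rank x == rank (bar (tgt k)) then rank (bar (src k)) else rank x.
Proof. by rewrite -!letter_eq_rank /swap; do !case: ifP. Qed.

(** A simple reflection permutes the positive roots other than alpha_k: a pair (x, y) stands for the
    root wt(x) - wt(y), and the four excluded pairs are alpha_k and -alpha_k, each in two forms. *)
Lemma rank_swap k x y : x.2 != y.2 ->
    (x, y) \notin [:: (src k, tgt k); (tgt k, src k);
                      (bar (src k), bar (tgt k)); (bar (tgt k), bar (src k))] ->
  (rank (swap k x) < rank (swap k y))%N = (rank x < rank y)%N.
Proof.
have lt_rank z : (rank z < m.*2)%N by have := rank_bar z; have := m_gt1; lia.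
have := lt_rank x; have := lt_rank y; have := ltn_ord k.
rewrite index_eq_rank !inE !xpair_eqE !letter_eq_rank.
rewrite !rank_swapE !rank_barE rank_src rank_tgt.
by case: (ltnP k.+1 m) => hk; do !case: ifP; lia.
Qed.

(** Applying [swap k] to both entries carries the inversions of s_k v to those of v and two further
    pairs, the two forms of -alpha_k, which come from the new inversion alpha_k. *)
Lemma len_simple k v : coord v (tgt k) < coord v (src k) ->
  len (simple_refl k *m v) = (len v).+2.
Proof.
move=> lt_v; pose f (p : letter m * letter m) := (swap k p.1, swap k p.2).
have f_inj : injective f.
  by move=> [x y] [x' y'] [/swap_inj-> /swap_inj->].
have index_bar x y : (x.2 == y.2) = (x == y) || (x == bar y).
  by rewrite !letter_eqE -val_eqE; case: x y => [[] [a ha]] [[] [c hc]] /=; lia.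
have index_swap x y : ((swap k x).2 == (swap k y).2) = (x.2 == y.2).
  by rewrite !index_bar -swap_bar !(inj_eq (@swap_inj k)).
have index_pair x y : x.2 == y.2 ->
    ((x, y) == (tgt k, src k)) || ((x, y) == (bar (src k), bar (tgt k))) = false.
  have := tgt_neq_src k.
  by move=> neq xy; apply/norP; split; apply: contraTN xy => /eqP[-> ->];
    rewrite /= ?neq // eq_sym neq.
have lt1 := rank_src_tgt k; have lt2 := rank_bar_tgt_src k.
have pairE (x y x' y' : letter m) : (x, y) == (x', y') = (x == x') && (y == y').
  exact: xpair_eqE.
have lt_vF : coord v (src k) < coord v (tgt k) = false by rewrite lt_gtF.
have lt1F : (rank (tgt k) < rank (src k))%N = false by lia.
have lt2F : (rank (bar (src k)) < rank (bar (tgt k)))%N = false by lia.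
have -> : len (simple_refl k *m v) =
    #|inv_set v :|: [set (tgt k, src k); (bar (src k), bar (tgt k))]|.
  rewrite -[RHS](card_preimset _ f_inj); apply: eq_card => -[x y].
  rewrite !inE /f /= !coord_simple_refl index_swap.
  case: (boolP (x.2 == y.2)) => [eq_xy | neq_xy] /=.
    by rewrite index_pair // index_swap.
  have [four | not_four] := boolP ((x, y) \in
     [:: (src k, tgt k); (tgt k, src k);
         (bar (src k), bar (tgt k)); (bar (tgt k), bar (src k))]).
    have := four; rewrite !inE.
    case/or4P => /eqP[-> ->]; rewrite ?swap_bar ?swap_src ?swap_tgt.
    - by rewrite eqxx lt1 lt_v orbT.
    - by rewrite lt1F lt_vF !andbF !pairE !node_neqE.
    - by rewrite lt2F !coord_bar !ltrN2 lt_vF !andbF !pairE !node_neqE.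
    - by rewrite eqxx lt2 !coord_bar ltrN2 lt_v !orbT.
  rewrite rank_swap //; move: not_four; rewrite !inE !pairE !negb_or.
  rewrite -!(inj_eq (@swap_inj k) x) -!(inj_eq (@swap_inj k) y).
  rewrite !swap_bar !swap_src !swap_tgt => /and4P[/negbTE-> _ _ /negbTE->].
  by rewrite !orbF.
rewrite cardsU [#|[set _; _]|]cards2 pairE !node_neqE /=.
rewrite (_ : _ :&: _ = set0) ?cards0; first by rewrite subn0 addn2.
apply/setP => -[x y]; rewrite !inE; apply/negbTE/negP => /andP[/and3P[_ /= lt_xy _]].
by case/orP => /eqP[xE yE]; move: lt_xy; rewrite xE yE; lia.
Qed.

Lemma len_rho : len rho = 0%N.
Proof.
apply/eqP; rewrite cards_eq0; apply/eqP/setP => -[x y]; rewrite !inE /= !coord_rho.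
by apply/negbTE/negP => /and3P[_]; lia.
Qed.

Lemma coord_word_neq w k :
  coord (weyl_word w *m rho) (src k) != coord (weyl_word w *m rho) (tgt k).
Proof.
rewrite !coord_word (inj_eq coord_rho_inj) (inj_eq (@word_perm_inj w)).
by rewrite src_tgtF.
Qed.

Lemma len_simple_neg k v : coord v (src k) < coord v (tgt k) ->
  len v = (len (simple_refl k *m v)).+2.
Proof.
move=> lt_v; rewrite -{1}(simple_reflK k v) len_simple //.
by rewrite !coord_simple_refl swap_src swap_tgt.
Qed.

Lemma len_word w : (len (weyl_word w *m rho) <= (size w).*2)%N.
Proof.
elim: w => [|k w IHw]; first by rewrite /weyl_word big_nil mul1mx len_rho.
rewrite weyl_word_cons /=; have := coord_word_neq w k.
by rewrite neq_lt => /orP[/len_simple_neg | /len_simple]; lia.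
Qed.

(** Distinct odd integers differ by at least 2, so the bound at [i0] caps every later value, while
    the spin inequality gives u_{m-2} >= 3 and bounds the earlier values from below. The bounds
    meet, except at the last index, where a sign stays open. *)
Lemma decreasing_odd (u : nat -> int) i0 :
    (i0.+1 < m)%N -> (forall i, exists a : int, u i = 2 * a + 1) ->
    u i0 <= ((m - i0).*2.-1)%:Z ->
    (forall i, (i0 <= i)%N -> (i.+1 < m)%N -> u i.+1 < u i) ->
    - u m.-1 < u (m - 2)%N ->
  (forall i, (i0 <= i)%N -> (i.+1 < m)%N -> u i = ((m - i).*2.-1)%:Z) /\
  (u m.-1 = 1 \/ u m.-1 = -1).
Proof.
move=> i0_m u_odd u_i0 u_dec u_spin.
have upper d : (i0 + d < m)%N -> u (i0 + d)%N <= ((m - (i0 + d)).*2.-1)%:Z.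
  elim: d => [|d IHd] d_m; first by rewrite addn0.
  have [a ha] := u_odd (i0 + d)%N; have [a' ha'] := u_odd (i0 + d).+1.
  have := u_dec (i0 + d)%N; rewrite addnS in d_m *; have := IHd; lia.
have [a ha] := u_odd m.-1; have [a' ha'] := u_odd (m - 2)%N.
have lt_last : u m.-1 < u (m - 2)%N.
  by have := u_dec (m - 2)%N; rewrite (_ : (m - 2).+1 = m.-1); lia.
have lower d : (i0 + d.+2 <= m)%N -> (d.+1.*2.+1)%:Z <= u (m - d.+2)%N.
  elim: d => [|d IHd] d_m; first by lia.
  have [y hy] := u_odd (m - d.+2)%N; have [y' hy'] := u_odd (m - d.+3)%N.
  have := u_dec (m - d.+3)%N; rewrite (_ : (m - d.+3).+1 = m - d.+2)%N; last lia.
  by have := IHd; lia.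
split=> [i i0_i i_m |].
  have := upper (i - i0)%N; rewrite subnKC // => /(_ (ltnW i_m)).
  have := lower (m - i - 2)%N; rewrite (_ : (m - (m - i - 2).+2 = i)%N); lia.
by have := upper (m - 2 - i0)%N; rewrite subnKC; lia.
Qed.

(** The product of the coordinates is an invariant that W(D_m) has and the group of all signed
    permutations lacks: each simple reflection exchanges two coordinates and changes either no sign
    or two. *)
Lemma prod_simple_refl k v :
  \prod_i coord (simple_refl k *m v) (false, i) = \prod_i coord v (false, i).
Proof.
have neq : (src k).2 != (tgt k).2 by rewrite eq_sym tgt_neq_src.
have split_prod u : \prod_i coord u (false, i) =
    coord u (src k) * coord u (false, (tgt k).2) *
    \prod_(i | (i != (src k).2) && (i != (tgt k).2)) coord u (false, i).
  rewrite (bigD1 (src k).2) // (bigD1 (tgt k).2) 1?eq_sym //=; exact: mulrA.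
rewrite !split_prod; congr (_ * _); last first.
  apply: eq_bigr => i /andP[i_src i_tgt]; rewrite coord_simple_refl /swap.
  rewrite !letter_eqE /= -![_ == _ :> nat]/(_ == _ :> 'I_m).
  by rewrite (negbTE i_src) (negbTE i_tgt) !andbF.
have [tgtE | tgtE] : (false, (tgt k).2) = tgt k \/ (false, (tgt k).2) = bar (tgt k).
  by rewrite /bar; case: (tgt k) => [[] a]; [right | left].
  by rewrite tgtE !coord_simple_refl swap_src swap_tgt mulrC.
by rewrite tgtE !coord_simple_refl swap_bar swap_src swap_tgt !coord_bar; lia.
Qed.

Lemma prod_word w v :
  \prod_i coord (weyl_word w *m v) (false, i) = \prod_i coord v (false, i).
Proof.
elim: w => [|k w IHw]; first by rewrite /weyl_word big_nil mul1mx.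
by rewrite weyl_word_cons prod_simple_refl.
Qed.

Lemma swap_below (i0 : nat) k x : (i0.+1 < m)%N -> (i0 <= k)%N ->
  if (x.2 < i0)%N then swap k x = x else (i0 <= (swap k x).2)%N.
Proof.
move=> i0_m i0_k.
have src_i0 : (i0 <= (src k).2)%N by rewrite src_val; case: ifP; lia.
have tgt_i0 : (i0 <= (tgt k).2)%N by rewrite tgt_val; case: ifP; lia.
rewrite /swap; case: ltnP => x_i0; last by do !case: ifP => // _.
have neq y : (i0 <= y.2)%N -> (x == y) = false.
  by move=> y_i0; apply: contraTF x_i0 => /eqP->; rewrite -leqNgt.
by rewrite !neq.
Qed.

Lemma word_perm_below (i0 : nat) w x :
    (i0.+1 < m)%N -> all (fun k : 'I_m => i0 <= k)%N w ->
  if (x.2 < i0)%N then word_perm w x = x else (i0 <= (word_perm w x).2)%N.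
Proof.
move=> i0_m; elim: w x => [|k w IHw] x /=; first by case: ltnP.
move=> /andP[i0_k /IHw]/(_ (swap k x)); have := swap_below x i0_m i0_k.
by case: (ltnP x.2 i0) => x_i0; [move=> ->; rewrite x_i0 | rewrite ltnNge => ->].
Qed.

Lemma rank_index x : (x.2 <= rank x <= m.*2.-1 - x.2)%N.
Proof. by case: x => [[] [a ha]]; rewrite /rank /=; lia. Qed.

Lemma prod_signs (i0 : nat) (c e : int) : (i0 < m)%N ->
  \prod_(i < m) (if (i < i0)%N then 1 else if (i.+1 < m)%N then c else e) =
  c ^+ (m.-1 - i0) * e.
Proof.
move=> i0_m; have m_gt0 : (0 < m)%N by lia.
rewrite -(big_mkord predT (fun i =>
  if (i < i0)%N then 1 else if (i.+1 < m)%N then c else e)).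
rewrite -{1}(prednK m_gt0) big_nat_recr //= (prednK m_gt0) ltnn.
rewrite leqNgt i0_m /=.
rewrite (big_cat_nat (n := i0)) //=; last by lia.
rewrite big_nat_cond big1 ?mul1r => [|i /andP[/andP[_ ->]] //].
rewrite -prodr_const_nat; congr (_ * _); rewrite big_nat_cond [RHS]big_nat_cond.
by apply: eq_bigr => i /andP[/andP[i0_i i_m] _]; rewrite ltnNge i0_i /= ifT //; lia.
Qed.

(* The last coordinate is only known up to sign from the inequalities; the sign
   is recovered from the product of the coordinates, a W-invariant in type D. *)
Lemma extremal_word (i0 : nat) w (c : int) : c = 1 \/ c = -1 ->
    (i0.+1 < m)%N -> all (fun k : 'I_m => i0 <= k)%N w ->
    (forall k : 'I_m, (i0 <= k)%N ->
       c * coord (weyl_word w *m rho) (tgt k) < c * coord (weyl_word w *m rho) (src k)) ->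
  forall i : 'I_m, coord (weyl_word w *m rho) (false, i) =
    (if (i < i0)%N then 1 else if (i.+1 < m)%N then c else c ^+ (m.-1 - i0)) *
    coord rho (false, i).
Proof.
move=> c_sign i0_m w_i0; set v := weyl_word w *m rho => v_dec.
have k0 : 'I_m by exists 0%N; lia.
(* [decreasing_odd] takes a function on all naturals; beyond m the default [k0] supplies values of
   which only oddness is asked. *)
pose u i := c * coord v (false, insubd k0 i).
have uE (i : 'I_m) : u i = c * coord v (false, i) by rewrite /u valKd.
have odd_u i : exists a : int, u i = 2 * a + 1.
  rewrite /u coord_word coord_rho; set r := rank _.
  by case: c_sign => ->; [exists (m.-1%:Z - r%:Z) | exists (r%:Z - m%:Z)]; lia.
have below x := word_perm_below x i0_m w_i0.
have [|i i0_i i_m||dec last] := @decreasing_odd u i0 i0_m odd_u.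
- have i0_m' : (i0 < m)%N by lia.
  rewrite -[i0 in u i0]/(val (Ordinal i0_m')) uE coord_word coord_rho.
  have := below (false, Ordinal i0_m'); rewrite /= ltnn => le_p.
  by have := rank_index (word_perm w (false, Ordinal i0_m')); case: c_sign => ->; lia.
- have i_m' : (i < m)%N by lia.
  have := v_dec (Ordinal i_m') i0_i; rewrite /src /tgt /= i_m -!uE /=.
  by rewrite modn_small.
- have m_m : (m.-1 < m)%N by lia.
  have m2_m : (m - 2 < m)%N by lia.
  have := v_dec (Ordinal m_m); rewrite (_ : tgt _ = bar (false, Ordinal m_m)); last first.
    by rewrite /tgt ifF //=; lia.
  rewrite (_ : src _ = (false, Ordinal m2_m)); last first.
    by apply/eqP; rewrite letter_eqE src_val ifF /=; lia.
  by rewrite coord_bar mulrN -!uE /=; apply; lia.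
have m_m : (m.-1 < m)%N by lia.
pose e := coord v (false, Ordinal m_m).
have e_sign : e = 1 \/ e = -1.
  by have := uE (Ordinal m_m); rewrite /= -/e; case: c_sign => ->; lia.
have vE i : coord v (false, i) = (if (i < i0)%N then 1 else
    if (i.+1 < m)%N then c else e) * coord rho (false, i).
  case: ifP => [i_i0 | /negbT]; last rewrite -leqNgt => i0_i.
    by have := below (false, i); rewrite /= i_i0 mul1r coord_word => ->.
  case: ifP => [i_m | i_m].
    have := dec i i0_i i_m; rewrite uE coord_rho /rank /=.
    by case: c_sign => ->; lia.
  have -> : i = Ordinal m_m by apply: val_inj => /=; have := ltn_ord i; lia.
  by rewrite -/e coord_rho /rank /=; lia.
(* Comparing products and cancelling that of [rho], whose coordinates are odd, leaves c^(m-1-i0) e =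
   1 with both factors signs. *)
suff -> : c ^+ (m.-1 - i0) = e by exact: vE.
have := prod_word w rho; rewrite -/v.
under eq_bigr do rewrite vE; rewrite big_split /= prod_signs; last by lia.
have rho_neq0 : \prod_i coord rho (false, i) != 0.
  by apply/prodf_neq0 => i _; rewrite coord_rho; lia.
rewrite -[RHS]mul1r => /(mulIf rho_neq0) ce.
have c2 : c ^+ (m.-1 - i0) * c ^+ (m.-1 - i0) = 1.
  by rewrite -exprMn; case: c_sign => ->; rewrite ?mulrNN mul1r expr1n.
have e2 : e * e = 1 by case: e_sign => ->.
by rewrite -[LHS]mulr1 -e2 mulrA ce mul1r.
Qed.

(** [rho] takes distinct values on all letters, so its stabilizer is trivial. *)
Lemma weyl_word_rho_inj w w' :
  weyl_word w *m rho = weyl_word w' *m rho -> weyl_word w = weyl_word w'.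
Proof.
move=> eq_rho; apply: mulmx_col_inj => v; apply: coord_inj => x.
rewrite !coord_word; congr (coord v _); apply: coord_rho_inj.
by rewrite -!coord_word eq_rho.
Qed.

(** As long as w rho is not dominant, some simple reflection on the left lowers [len] by 2; once it
    is dominant, w is trivial. Together with [len_word], this makes [len] twice the Coxeter
    length. *)
Lemma short_word w : exists2 u, weyl_word u = weyl_word w &
  (size u).*2 = len (weyl_word w *m rho).
Proof.
have [d] := ubnP (len (weyl_word w *m rho)); elim: d w => // d IHd w lt_d.
case: (pickP [pred k | coord (weyl_word w *m rho) (src k) <
                       coord (weyl_word w *m rho) (tgt k)]) => /= [k | no_neg].
  move=> /len_simple_neg; rewrite -weyl_word_cons => len_w.
  have [|u uE u_len] := IHd (k :: w); first by lia.
  exists (k :: u); last by rewrite len_w /= doubleS u_len.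
  apply: mulmx_col_inj => v; rewrite weyl_word_cons uE weyl_word_cons.
  exact: simple_reflK.
have w_rho : weyl_word w *m rho = rho.
  apply: coord_inj => x.
  suff wE i : coord (weyl_word w *m rho) (false, i) = coord rho (false, i).
    by case: x => [[] i] //; rewrite -[(true, i)]/(bar (false, i)) !coord_bar wE.
  (* With c = 1 and the whole diagram: a dominant vector in the orbit of [rho] is [rho] itself. *)
  rewrite (@extremal_word 0 w 1) //; first by rewrite expr1n; case: ifP; rewrite mul1r.
  - by left.
  - by apply/allP.
  - move=> k _; rewrite !mul1r lt_neqAle eq_sym coord_word_neq /=.
    by have := no_neg k; rewrite /= leNgt => ->.
exists [::]; last by rewrite w_rho len_rho.
by apply: weyl_word_rho_inj; rewrite w_rho /weyl_word big_nil mul1mx.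
Qed.

Lemma reduced_word_len u g : reduced_word u g -> (size u).*2 = len (g *m rho).
Proof.
move=> [uE u_min]; have [u' u'E u'_len] := short_word u.
have := u_min u'; rewrite u'E uE => /(_ erefl); have := len_word u.
by rewrite -uE -u'_len; lia.
Qed.

Lemma reduced_word_ex w : exists u, reduced_word u (weyl_word w).
Proof.
have [u uE u_len] := short_word w; exists u; split=> // v vE.
by have := len_word v; rewrite vE -u_len; lia.
Qed.

Lemma in_parabolic_cons J k g : k \in J -> in_parabolic J g ->
  in_parabolic J (simple_refl k *m g).
Proof.
move=> kJ [w w_J <-]; exists (k :: w); first by rewrite /= w_J andbT.
by rewrite /weyl_word big_cons.
Qed.

(** [len] is bounded by the number of pairs of letters, so repeated improvement stops; asking
    whether a longer element of W_J exists is a classical case distinction. *)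
Lemma max_len_ex J : exists2 g, in_parabolic J g &
  forall h, in_parabolic J h -> (len (h *m rho) <= len (g *m rho))%N.
Proof.
have step d g : in_parabolic J g -> (#|{: letter m * letter m}| - len (g *m rho) < d)%N ->
    exists2 g, in_parabolic J g &
      forall h, in_parabolic J h -> (len (h *m rho) <= len (g *m rho))%N.
  elim: d g => // d IHd g g_J lt_d.
  case: (classic (exists2 h, in_parabolic J h & (len (g *m rho) < len (h *m rho))%N)).
    move=> [h h_J lt_gh]; apply: (IHd h) => //.
    have : (len (h *m rho) <= #|{: letter m * letter m}|)%N := max_card _.
    by lia.
  move=> no_h; exists g => // h h_J; rewrite leqNgt; apply/negP => lt_gh.
  by apply: no_h; exists h.
apply: (step _ 1%:M _ (ltnSn _)); exists [::] => //.
by rewrite /weyl_word big_nil.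
Qed.

Lemma longest_is_longest J : is_longest J (longest J).
Proof.
apply: (epsilon_spec (inhabits 1%:M) (is_longest J)).
have [g g_J g_max] := max_len_ex J; exists g; split=> // h u v h_J.
by move=> /reduced_word_len hu /reduced_word_len hv; have := g_max h h_J; lia.
Qed.

(** Otherwise s_k times the longest element would still lie in W_J and be longer, by
    [len_simple]. *)
Lemma longest_antidominant J k : k \in J ->
  coord (longest J *m rho) (src k) < coord (longest J *m rho) (tgt k).
Proof.
move=> kJ; have [[w w_J wE] w_max] := longest_is_longest J.
rewrite lt_neqAle -{1 2}wE coord_word_neq leNgt /=; apply/negP => /len_simple.
have kw_J := in_parabolic_cons kJ (ex_intro2 _ _ w w_J wE).
have [u u_red] := reduced_word_ex (k :: w); have [v v_red] := reduced_word_ex w.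
have kwE : weyl_word (k :: w) = simple_refl k *m longest J.
  by rewrite -wE /weyl_word big_cons.
rewrite wE kwE in u_red v_red; have := w_max _ _ _ kw_J u_red v_red.
by move: (reduced_word_len u_red) (reduced_word_len v_red); rewrite -mulmxA; lia.
Qed.

(** The parabolic subgroup is {1, s_k}, and the identity is excluded because it leaves [rho]
    dominant. *)
Lemma longest1 k : longest [set k] = simple_refl k.
Proof.
have [[w w_k wE] _] := longest_is_longest [set k].
have := longest_antidominant (set11 k); rewrite -wE => neg_k.
have [w1 | //] : weyl_word w = 1%:M \/ weyl_word w = simple_refl k.
  elim: w w_k {wE neg_k} => [|k' w IHw] /=; first by left; rewrite /weyl_word big_nil.
  rewrite inE => /andP[/eqP-> /IHw]; rewrite /weyl_word big_cons -/(weyl_word w).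
  case=> ->; [right; exact: mulmx1 | left].
  by apply: mulmx_col_inj => v; rewrite -mulmxA simple_reflK mul1mx.
move: neg_k; rewrite w1 mul1mx !coord_rho; have := rank_src_tgt k; lia.
Qed.

Lemma theta1 k : theta [set k] k = k.
Proof. by rewrite /theta; case: pickP => //= k'; rewrite inE => /andP[/eqP]. Qed.

Lemma simple_root_inj : injective (@simple_root m).
Proof.
suff lt_root k k' : simple_root k = simple_root k' -> (k.+1 < m)%N -> k = k'.
  move=> k k' eq_k; case: (ltnP k.+1 m) => [/(lt_root _ _ eq_k) // | k_m].
  case: (ltnP k'.+1 m) => [/(lt_root _ _ (esym eq_k)) // | k'_m].
  by apply: val_inj => /=; have := ltn_ord k; have := ltn_ord k'; lia.
move=> /matrixP eq_k k_m; apply: val_inj => /=.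
have := eq_k (Ordinal k_m) ord0; rewrite !mxE /= k_m eqxx.
rewrite (_ : (k.+1 == k :> nat) = false); last by lia.
by case: ifP => _ /=; do ![case: eqP => //=]; lia.
Qed.

Lemma thetaE J k k' : k' \in J ->
  simple_root k' = - (longest J *m simple_root k) -> theta J k = k'.
Proof.
move=> k'J k'E; rewrite /theta; case: pickP => [k2 | /(_ k')] /=.
  by rewrite -k'E => /andP[_ /eqP/simple_root_inj].
by rewrite k'J -k'E eqxx.
Qed.

End Weyl.
(** * The cactus maps of a node and of a tail *)

Section CactusNode.

Variables (n : nat) (k : 'I_m).
Implicit Types b : crow m n.

(* The k-strings are the level sets of string_inv: going down a k-string turns
   bar (tgt k) into bar (src k) as long as bar (tgt k) outnumbers tgt k, and
   then src k into tgt k. *)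
Definition string_inv b x : nat :=
  if x == src k then cnt b (src k) + (cnt b (tgt k) - cnt b (bar (tgt k)))
  else if x == bar (src k) then
    cnt b (bar (src k)) + (cnt b (bar (tgt k)) - cnt b (tgt k))
  else if (x == tgt k) || (x == bar (tgt k)) then
    minn (cnt b (tgt k)) (cnt b (bar (tgt k)))
  else cnt b x.

Lemma cactus_node : @cactus m n [set k] =1 act (swap k).
Proof.
have swap_src_bar : swap k (bar (src k)) = bar (tgt k) by rewrite swap_bar swap_src.
have swap_tgt_bar : swap k (bar (tgt k)) = bar (src k) by rewrite swap_bar swap_tgt.
have swap_id x : x != src k -> x != tgt k -> x != bar (src k) -> x != bar (tgt k) ->
    swap k x = x.
  by rewrite /swap; do 4!move=> /negbTE->.
have cnt_swap b := cnt_act (swapK k) (swap_bar k) b.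
apply: (@cactusE n [set k] string_inv).
- move=> k' b b'; rewrite inE => /eqP->{k'}.
  case: row_eP => // c hc => [|hc'] hcnt [<-{b'}] x; have := hcnt x;
    counts_at k hcnt => h1 h2 h3 h4; rewrite /string_inv;
    case: (eqVneq x (src k)) => [_ | n1]; [lia | | lia | ];
    case: (eqVneq x (bar (src k))) => [_ | n2]; [lia | | lia | ];
    case: (eqVneq x (tgt k)) => [_ | n3] /=; [lia | | lia | ];
    case: (eqVneq x (bar (tgt k))) => [_ | n4] /=; lia.
(* In a highest row [bar (src k)] is absent and [tgt k] does not outnumber [bar (tgt k)], so the
   invariant gives back all counts. *)
- move=> b b' eq_inv high high'; apply: cnt_inj => x.
  have := high k (set11 k); have := high' k (set11 k).
  case: row_eP => // hb hb0 _; case: row_eP => // hb' hb0' _.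
  have := eq_inv x.
  move: (eq_inv (src k)) (eq_inv (tgt k)) (eq_inv (bar (src k))) (eq_inv (bar (tgt k))).
  rewrite /string_inv !eqxx !(node_neqE k) /= => h1 h2 h3 h4.
  case: (eqVneq x (src k)) => [-> | n1]; first by lia.
  case: (eqVneq x (bar (src k))) => [-> | n2]; first by lia.
  case: (eqVneq x (tgt k)) => [-> | n3] /=; first by lia.
  by case: (eqVneq x (bar (tgt k))) => [-> | n4] /=; lia.
- by move=> k'; rewrite inE => /eqP->; rewrite theta1 set11.
- by move=> k'; rewrite inE => /eqP->; rewrite !theta1.
- exact: swapK.
- exact: swap_bar.
- by move=> v x; rewrite longest1 coord_simple_refl.
- move=> b x; rewrite /string_inv !cnt_swap.
  rewrite !(swap_src, swap_tgt, swap_src_bar, swap_tgt_bar) !barK.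
  case: (eqVneq x (src k)) => [_ | n1]; first by lia.
  case: (eqVneq x (bar (src k))) => [_ | n2]; first by lia.
  case: (eqVneq x (tgt k)) => [_ | n3] /=; first by lia.
  case: (eqVneq x (bar (tgt k))) => [_ | n4] /=; first by lia.
  by rewrite swap_id //; lia.
move=> k' b; rewrite inE => /eqP->{k'}; rewrite theta1.
have cnt_b := cnt_swap b.
move: (cnt_b (src k)) (cnt_b (tgt k)) (cnt_b (bar (src k))) (cnt_b (bar (tgt k))).
rewrite !(swap_src, swap_tgt, swap_src_bar, swap_tgt_bar) !barK => a1 a2 a3 a4.
have act_eq (c d : crow m n) : (forall x, cnt c x = cnt (act (swap k) d) x) ->
    Some c = omap (act (swap k)) (Some d) by move=> /cnt_inj->.
have other x (c d : crow m n) : swap k x = x -> cnt c x = cnt (act (swap k) b) x ->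
    cnt d x = cnt b x -> cnt d (bar x) = cnt b (bar x) ->
    cnt c x = cnt (act (swap k) d) x.
  by move=> sx ->; rewrite !cnt_swap sx => -> ->.
(* The branch of e is decided by the [src] pair of b, that of f by the [tgt] pair, so all four
   combinations of changed letters occur; only a zero against a nonzero value is contradictory. *)
case: (row_eP k (act (swap k) b)) => [|c hc hcnt|c hc hc' hcnt];
  case: (row_fP k b) => [|d hd hcntd|d hd hd' hcntd] //=;
  try lia; apply: act_eq => x; counts_at k hcnt => c1 c2 c3 c4;
  counts_at k hcntd => d1 d2 d3 d4.
all: case: (eqVneq x (src k)) => [-> | n1];
  first by rewrite [RHS]cnt_swap swap_src; lia.
all: case: (eqVneq x (tgt k)) => [-> | n2];
  first by rewrite [RHS]cnt_swap swap_tgt; lia.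
all: case: (eqVneq x (bar (src k))) => [-> | n3];
  first by rewrite [RHS]cnt_swap swap_src_bar !barK; lia.
all: case: (eqVneq x (bar (tgt k))) => [-> | n4];
  first by rewrite [RHS]cnt_swap swap_tgt_bar !barK; lia.
all: apply: other; first exact: swap_id.
all: have := hcnt x; have := hcntd x; have := hcntd (bar x); rewrite !bar_eqC ?barK.
all: rewrite (negbTE n1) (negbTE n2) (negbTE n3) (negbTE n4); lia.
Qed.

End CactusNode.

(** * The longest element and the cactus map of a tail *)

Section CactusTail.

Variable i0 : nat.
Hypothesis i0_m : i0.+2 < m.

Let J : {set 'I_m} := [set k : 'I_m | i0 <= k].

(* The action of the longest element: it negates the coordinates from i0 on,
   except the last one when their number m - i0 is odd. *)
Definition tau x : letter m :=
  if (x.2 < i0) || (x.2.+1 == m) && ~~ odd (m.-1 - i0) then x else bar x.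

(** The diagram automorphism induced by -w_{0,J}: trivial when |J| = m - i0 is even, otherwise the
    exchange of the two spin nodes. *)
Definition opp_node k : 'I_m :=
  if odd (m.-1 - i0) || (k.+2 < m) then k
  else if k.+1 < m then ordS k else ord_pred k.

Lemma tau_bar x : tau (bar x) = bar (tau x).
Proof. by rewrite /tau /=; case: ifP. Qed.

Lemma tauK : involutive tau.
Proof. by move=> x; rewrite {2}/tau; case: ifP => hx; rewrite ?tau_bar /tau hx ?barK. Qed.

Lemma opp_node_val k : opp_node k =
  (if odd (m.-1 - i0) || (k.+2 < m) then k : nat
   else if k.+1 < m then k.+1 else k.-1) :> nat.
Proof.
rewrite /opp_node; case: ifP => // _; case: ifP => k_m; first by rewrite /= modn_small.
have -> : ord_pred k = (k + m).-1 %% m :> nat by [].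
have k_lt := ltn_ord k.
by rewrite (_ : (k + m).-1 = k.-1 + m) ?modnDr ?modn_small; lia.
Qed.

Lemma opp_nodeK : involutive opp_node.
Proof.
move=> k; apply: val_inj => /=; rewrite !opp_node_val; have := ltn_ord k.
by case: (odd _) => //=; case: (ltnP k.+2 m); case: (ltnP k.+1 m) => /=;
  do !case: ifP; lia.
Qed.

Lemma opp_node_in k : k \in J -> opp_node k \in J.
Proof. by rewrite !inE opp_node_val; do !case: ifP; lia. Qed.

Lemma tau_index x : (tau x).2 = x.2.
Proof. by rewrite /tau; case: ifP. Qed.

Lemma tau_sign x :
  (tau x).1 = (x.1 == (x.2 < i0) || (x.2.+1 == m) && ~~ odd (m.-1 - i0)).
Proof. by rewrite /tau; case: ifP; case: x => [[]]. Qed.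

Lemma tau_src k : k \in J -> tau (src k) = bar (src (opp_node k)).
Proof.
rewrite inE => k_i0; apply/eqP; rewrite letter_eqE tau_index tau_sign /=.
rewrite !src_val opp_node_val; have := ltn_ord k.
by case: (odd _) => /=; case: (ltnP k.+1 m); case: (ltnP k.+2 m) => /=;
  do ?case: ifP; lia.
Qed.

Lemma tau_tgt k : k \in J -> tau (tgt k) = bar (tgt (opp_node k)).
Proof.
rewrite inE => k_i0; apply/eqP; rewrite letter_eqE tau_index tau_sign /=.
rewrite !tgt_sign !tgt_val opp_node_val; have := ltn_ord k.
by case: (odd _) => /=; case: (ltnP k.+1 m); case: (ltnP k.+2 m) => /=;
  do ?case: ifP; lia.
Qed.

(** Agreement on [rho] suffices, as [rho] is injective on letters. There [extremal_word] applies
    with c = -1 by antidominance, and its last sign (-1)^(m-1-i0) is the parity condition in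
    [tau]. *)
Lemma coord_longest v x : coord (longest J *m v)%R x = coord v (tau x).
Proof.
have [[w w_J wE] _] := longest_is_longest J.
have w_i0 : all (fun k : 'I_m => i0 <= k) w.
  by apply: sub_all w_J => k; rewrite /= inE.
suff tauE y : word_perm w y = tau y by rewrite -wE coord_word tauE.
apply: coord_rho_inj; rewrite -coord_word.
suff wtE i : coord (weyl_word w *m rho)%R (false, i) = coord rho (tau (false, i)).
  case: y => [[] i] //; rewrite -[(true, i)]/(bar (false, i)).
  by rewrite tau_bar !coord_bar wtE.
rewrite (@extremal_word i0 w (-1)%R) //; first last.
- move=> k k_i0; rewrite !mulN1r ltrN2 wE; apply: longest_antidominant.
  by rewrite inE.
- by lia.
- by right.
rewrite /tau /=; case: ifP => _ /=; first by rewrite mul1r.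
have i_m := ltn_ord i; case: (ltnP i.+1 m) => im.
  by rewrite (_ : (i.+1 == m) = false) ?coord_bar ?mulN1r; lia.
have -> : (i.+1 == m) = true by lia.
rewrite -signr_odd /=; case: (odd _); first by rewrite /= expr1 mulN1r coord_bar.
by rewrite mul1r.
Qed.

Lemma theta_tail k : k \in J -> theta J k = opp_node k.
Proof.
move=> kJ; apply: thetaE; first exact: opp_node_in.
have coordN v y : coord (- v)%R y = (- coord v y)%R by rewrite /coord mxE mulrN.
apply: coord_inj => x; rewrite coordN coord_longest !coord_simple_rootE.
rewrite !(inv_eq tauK) ?tau_bar tau_src // tau_tgt // !barK; lia.
Qed.

Variable n : nat.
Implicit Types b : crow m n.

(** [tau] preserves the index of a letter, so minimum and difference come from the same pair and
    [act tau] just renames letters. *)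
Lemma cnt_tau b x : cnt (act tau b) x = cnt b (tau x).
Proof.
rewrite (cnt_act tauK tau_bar) /tau; case: ifP => _; rewrite ?barK; lia.
Qed.

(** The node conditions remove every \overline i with i0 <= i < m-1 (indices from 0). The two spin
    conditions compare m and \overline m both ways, so t_m = 0 removes both. The remaining [tgt k]
    are then bounded by absent letters. *)
Lemma highest_tail b (k1 : 'I_m) : k1 = i0 :> nat ->
    (forall k, k \in J -> row_e k b = None) ->
  forall x, i0 <= x.2 -> x != (false, k1) -> cnt b x = 0.
Proof.
move=> k1E high.
have {high}high k : k \in J ->
    cnt b (tgt k) <= cnt b (bar (tgt k)) /\ cnt b (bar (src k)) = 0.
  by move=> /high; case: row_eP.
have bar0 (i : 'I_m) : i0 <= i -> i.+1 < m -> cnt b (true, i) = 0.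
  move=> i_i0 i_m; have [|_] := high i; first by rewrite inE.
  by rewrite /src i_m.
have m_m : m.-1 < m by lia.
have mid0 s : cnt b (s, Ordinal m_m) = 0.
  have m2_m : m - 2 < m by lia.
  have [|le1 _] := high (Ordinal m2_m); first by rewrite inE /=; lia.
  have [|le2 _] := high (Ordinal m_m); first by rewrite inE /=; lia.
  have := cnt_middle b (erefl : (false, Ordinal m_m).2 = m.-1 :> nat).
  have t1 : tgt (Ordinal m2_m) = (false, Ordinal m_m).
    by apply/eqP; rewrite letter_eqE tgt_sign tgt_val /= ; case: ifP; lia.
  have t2 : tgt (Ordinal m_m) = (true, Ordinal m_m).
    by apply/eqP; rewrite letter_eqE tgt_sign tgt_val /= ; case: ifP; lia.
  rewrite t1 t2 /bar /= in le1 le2 *; case: s; lia.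
move=> [s i] /= i_i0 x_k1; have i_lt := ltn_ord i.
have [i_m | i_m] := ltnP i.+1 m; last first.
  by have -> : i = Ordinal m_m by apply: val_inj => /=; lia.
case: s x_k1 => x_k1; first exact: bar0.
have p_m : i.-1 < m by lia.
have i_k1 : i <> i0 :> nat.
  by move=> iE; move: x_k1; rewrite letter_eqE /= iE k1E eqxx.
have [|+ _] := high (Ordinal p_m); first by rewrite inE /=; lia.
have -> : tgt (Ordinal p_m) = (false, i).
  by apply/eqP; rewrite letter_eqE tgt_sign tgt_val /= ; case: ifP; lia.
by rewrite [cnt b (bar _)]bar0 //; lia.
Qed.

Lemma cactus_tail : @cactus m n J =1 act tau.
Proof.
have index_neq k x y : k \in J -> x.2 < i0 ->
    y \in [:: src k; tgt k; bar (src k); bar (tgt k)] ->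
    (x == y) = false.
  rewrite inE => kJ x_i0 y_k; rewrite letter_eqE (_ : (_ == y.2 :> nat) = false) ?andbF //.
  have : i0 <= y.2; last by lia.
  move: y_k; rewrite !inE => /or4P[] /eqP-> /=; rewrite ?src_val ?tgt_val;
    case: ifP; have := ltn_ord k; lia.
apply: (@cactusE n J (fun b x => if x.2 < i0 then cnt b x else 0)).
- move=> k b b' kJ eb x; case: ifP => // x_i0; move: eb.
  have k_i0 : i0 <= k by move: kJ; rewrite inE.
  case: row_eP => // c hc => [|hc'] hcnt [<-]; have := hcnt x;
    by rewrite !(index_neq k) ?inE ?eqxx ?orbT //= !addn0.
(* The invariant fixes the counts below [i0], [highest_tail] leaves one letter in the tail, and the
   total n fixes its count. *)
- move=> b b' eq_inv high high'; apply: cnt_inj.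
  have i0_lt : i0 < m by lia.
  have low := @highest_tail b (Ordinal i0_lt) erefl high.
  have low' := @highest_tail b' (Ordinal i0_lt) erefl high'.
  have other x : x != (false, Ordinal i0_lt) -> cnt b x = cnt b' x.
    move=> x_k1; case: (ltnP x.2 i0) => x_i0; last by rewrite low ?low'.
    by have := eq_inv x; rewrite /= x_i0.
  move=> x; case: (eqVneq x (false, Ordinal i0_lt)) => [-> | /other //].
  have := sum_cnt b; rewrite -{2}(sum_cnt b') (bigD1 (false, Ordinal i0_lt)) //=.
  rewrite [in RHS](bigD1 (false, Ordinal i0_lt)) //=.
  by rewrite (eq_bigr _ other) => /addIn.
- by move=> k kJ; rewrite theta_tail // opp_node_in.
- by move=> k kJ; rewrite !theta_tail ?opp_node_in // opp_nodeK.
- exact: tauK.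
- exact: tau_bar.
- exact: coord_longest.
- by move=> b x; rewrite cnt_tau /tau; case: (ltnP x.2 i0).
move=> k b kJ; rewrite theta_tail //.
have tau_eq x y : (x == tau y) = (tau x == y) by rewrite (inv_eq tauK).
have tau_tgt_bar : tau (bar (tgt k)) = tgt (opp_node k) by rewrite tau_bar tau_tgt ?barK.
have tau_src_bar : tau (bar (src k)) = src (opp_node k) by rewrite tau_bar tau_src ?barK.
have act_eq (c d : crow m n) : (forall x, cnt c x = cnt d (tau x)) ->
    Some c = omap (act tau) (Some d).
  by move=> eq_cd; congr Some; apply: cnt_inj => x; rewrite cnt_tau.
(* Barring turns the e-condition at k into the f-condition at [opp_node k], so, unlike for a node,
   only matching branches survive. *)
case: (row_eP k (act tau b)); case: (row_fP (opp_node k) b) => //;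
  rewrite !cnt_tau ?tau_src_bar ?tau_tgt_bar ?tau_tgt //; try lia.
- move=> d hd hcntd c hc hcnt; apply: act_eq => x.
  have := hcnt x; have := hcntd (tau x).
  by rewrite cnt_tau -tau_src // -tau_tgt // !(inj_eq (inv_inj tauK)); lia.
- move=> d hd hd' hcntd c hc hc' hcnt; apply: act_eq => x.
  have := hcnt x; have := hcntd (tau x).
  by rewrite cnt_tau -tau_src_bar -tau_tgt_bar !(inj_eq (inv_inj tauK)); lia.
Qed.

End CactusTail.

(** * Words of node maps compared with the map of a tail *)

Section CactusWord.

Variable n : nat.
Implicit Types b : crow m n.

Lemma cactus_word_act w b :
  (forall x, minn (cnt (cactus_word w b) x) (cnt (cactus_word w b) (bar x)) =
             minn (cnt b x) (cnt b (bar x))) /\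
  row_wt (cactus_word w b) = (weyl_word w *m row_wt b)%R.
Proof.
elim: w => [|k w [eq_min eq_wt]] /=; first by rewrite /weyl_word big_nil mul1mx.
rewrite cactus_node; split=> [x | ].
  by rewrite min_act //; [apply: swapK | apply: swap_bar].
apply: coord_inj => x; rewrite coord_wt_act; [| exact: swapK | exact: swap_bar].
by rewrite weyl_word_cons coord_simple_refl eq_wt.
Qed.

Lemma cactus_tail_word i0 w b : i0.+2 < m ->
    weyl_word w = longest [set k : 'I_m | i0 <= k] ->
  cactus [set k : 'I_m | i0 <= k] b = cactus_word w b.
Proof.
move=> i0_m wE; have [eq_min eq_wt] := cactus_word_act w b.
rewrite cactus_tail //; apply: row_eq => [x | ].
  by rewrite eq_min min_act //; [apply: tauK | apply: tau_bar].
apply: coord_inj => x; rewrite eq_wt wE coord_longest // coord_wt_act //.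
  exact: tauK.
exact: tau_bar.
Qed.

End CactusWord.

End Letters.

Theorem theorem6p6 (m : nat) (hm : 3 <= m) (j : nat) (hj : 1 <= j <= m - 2)
    (w : seq 'I_m)
    (hw : reduced_word w (longest [set k : 'I_m | j <= k.+1]))
    (n : nat) (hn : 1 <= n) (b : crow m n) :
  cactus [set k : 'I_m | j <= k.+1] b = cactus_word w b.
Proof.
have m_gt1 : 1 < m by lia.
have JE : [set k : 'I_m | j <= k.+1] = [set k : 'I_m | j.-1 <= k].
  by apply/setP => k; rewrite !inE; lia.
move: hw => [wE _]; rewrite JE in wE *.
by apply: cactus_tail_word => //; lia.
Qed.
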